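(* Let $H$ be a compact subgroup of a locally compact group $G$. Then the group $G$ has property (RD) if and only if the Hecke pair $(G,H)$ has property (RD).
   Context: $G$ carries a right Haar measure $\mu$, $H$ a Haar measure; since $H$ is compact, $\Delta_G|_H=\Delta_H=1$ and there is a right $G$-invariant measure $\nu$ on $H\backslash G$ satisfying Weil's formula. $\mathcal H(G,H)$ is the space of compactly supported continuous functions $f$ on $H\backslash G$ which are right $H$-invariant ($f(Hxh)=f(Hx)$), with product $f*g(Hx)=\int_{H\backslash G}f(Hxy^{-1})g(Hy)\,d\nu(Hy)$; the left regular representation $\lambda(f)\xi=f*\xi$ acts by bounded operators on $L^2(H\backslash G,\nu)$ (for compact $H$, $(G,H)$ is a Hecke pair). For $H=\{e\}$ this is $C_c(G)$ with convolution $f*g(x)=\int_Gf(xy^{-1})g(y)\,d\mu(y)$ acting on $L^2(G)$. A length function on $(G,H)$ is a Borel function $l:G\to[0,\infty)$ with $l(e)=0$, $l(g)=l(g^{-1})$, $l(gh)\le l(g)+l(h)$ and $l|_H=0$ (a length function on $G$ when $H=\{e\}$); it is locally bounded if the induced function on $H\backslash G$ is bounded on compact subsets. $(G,H)$ has property (RD) if there exist a locally bounded length function $l$ on $(G,H)$ and $s,c>0$ with $\|\lambda(f)\|\le c\big(\int_{H\backslash G}|f(Hx)|^2(1+l(x))^{2s}d\nu(Hx)\big)^{1/2}$ for all $f\in\mathcal H(G,H)$; the group $G$ has property (RD) if $(G,\{e\})$ does. *)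

(* Defs.v *)
From HB Require Import structures.
From mathcomp Require Import all_boot all_order all_algebra.
From mathcomp Require Import all_classical all_reals all_analysis.
From mathcomp Require Import complex.
Set Implicit Arguments. Unset Strict Implicit. Unset Printing Implicit Defensive.
Import Order.TTheory GRing.Theory Num.Theory.
Import numFieldTopology.Exports numFieldNormedType.Exports.
Local Open Scope classical_set_scope.
Local Open Scope ring_scope.

Notation Borel G := (g_sigma_algebraType (@open G)).

Definition lc_group (G : ptopologicalType) (mul : G -> G -> G) (inv : G -> G)
    (e : G) : Prop :=
  [/\ (forall x y z, mul x (mul y z) = mul (mul x y) z),
      (forall x, mul e x = x /\ mul x e = x),
      (forall x, mul (inv x) x = e /\ mul x (inv x) = e),
      continuous (fun p : G * G => mul p.1 p.2) /\ continuous inv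
    & hausdorff_space G /\ locally_compact [set: G]].

Definition compact_subgroup (G : ptopologicalType) (mul : G -> G -> G)
    (inv : G -> G) (e : G) (H : set G) : Prop :=
  [/\ H e, (forall x y, H x -> H y -> H (mul x y)),
      (forall x, H x -> H (inv x)) & compact H].

Definition right_haar (R : realType) (G : ptopologicalType)
    (mul : G -> G -> G) (mu : {measure set (Borel G) -> \bar R}) : Prop :=
  [/\ (forall (A : set (Borel G)) (g : G), measurable A ->
          mu [set mul x g | x in A] = mu A),
      (forall K : set G, compact K -> (mu K < +oo)%E),
      (forall U : set G, open U -> U !=set0 -> (0 < mu U)%E),
      (forall A : set (Borel G), measurable A ->
          mu A = ereal_inf [set mu U | U in [set U : set G | open U /\ A `<=` U]])
    & (forall U : set G, open U ->
          mu U = ereal_sup [set mu K | K in [set K : set G | compact K /\ K `<=` U]])].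

Definition sqmod (R : realType) (z : R[i]) : R :=
  (complex.Re z) ^+ 2 + (complex.Im z) ^+ 2.

Definition cintegral (R : realType) (G : ptopologicalType)
    (mu : {measure set (Borel G) -> \bar R}) (F : G -> R[i]) : R[i] :=
  ((Rintegral mu setT (fun x => complex.Re (F x)))
     +i* (Rintegral mu setT (fun x => complex.Im (F x))))%C.

(* The Hecke algebra H(G,H), functions on H\G being identified with
   left H-invariant functions on G: compactly supported continuous complex
   functions which are left and right H-invariant. *)
Definition hecke_elt (R : realType) (G : ptopologicalType)
    (mul : G -> G -> G) (H : set G) (f : G -> R[i]) : Prop :=
  [/\ continuous (fun x => complex.Re (f x) : R),
      continuous (fun x => complex.Im (f x) : R),
      (exists K : set G, compact K /\ forall x, f x != 0 -> K x),
      (forall h x, H h -> f (mul h x) = f x)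
    & (forall h x, H h -> f (mul x h) = f x)].

(* Elements of L^2(H\G, nu), as left H-invariant square integrable Borel
   functions on G (nu is the push-forward of mu, i.e. Weil's formula with
   the normalized Haar measure of the compact group H). *)
Definition L2_quot (R : realType) (G : ptopologicalType) (mul : G -> G -> G)
    (mu : {measure set (Borel G) -> \bar R}) (H : set G) (xi : G -> R[i]) : Prop :=
  [/\ measurable_fun [set: Borel G] (fun x => complex.Re (xi x)),
      measurable_fun [set: Borel G] (fun x => complex.Im (xi x)),
      (forall h x, H h -> xi (mul h x) = xi x)
    & (\int[mu]_x (sqmod (xi x))%:E < +oo)%E].

Definition conv (R : realType) (G : ptopologicalType) (mul : G -> G -> G)
    (inv : G -> G) (mu : {measure set (Borel G) -> \bar R})
    (f xi : G -> R[i]) : G -> R[i] :=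
  fun x => cintegral mu (fun y => f (mul x (inv y)) * xi y).

Definition length_fun (R : realType) (G : ptopologicalType) (mul : G -> G -> G)
    (inv : G -> G) (e : G) (H : set G) (l : G -> R) : Prop :=
  [/\ measurable_fun [set: Borel G] l /\ (forall x, 0 <= l x),
      l e = 0,
      (forall x, l (inv x) = l x),
      (forall x y, l (mul x y) <= l x + l y)
    & (forall h, H h -> l h = 0)].

(* l is bounded on compact subsets (for an H-bi-invariant l this is the same
   as the induced function on H\G being bounded on compact subsets) *)
Definition locally_bounded (R : realType) (G : ptopologicalType) (l : G -> R) :=
  forall K : set G, compact K -> exists M : R, forall x, K x -> l x <= M.

Definition wnorm2 (R : realType) (G : ptopologicalType)
    (mu : {measure set (Borel G) -> \bar R}) (f : G -> R[i]) (l : G -> R)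
    (s : R) : \bar R :=
  (\int[mu]_x (sqmod (f x) * (1 + l x) `^ (2 * s))%:E)%E.

(* Property (RD) for the Hecke pair (G,H):  ||lambda(f)|| <= c ||f||_{l,s},
   written out as ||f * xi||_2 <= c ||f||_{l,s} ||xi||_2 for all xi in L^2
   (in squared form). *)
Definition hecke_RD (R : realType) (G : ptopologicalType) (mul : G -> G -> G)
    (inv : G -> G) (e : G) (mu : {measure set (Borel G) -> \bar R})
    (H : set G) : Prop :=
  exists l : G -> R, [/\ length_fun mul inv e H l, locally_bounded l &
    exists s c : R, [/\ 0 < s, 0 < c &
      forall f : G -> R[i], hecke_elt mul H f ->
      forall xi : G -> R[i], L2_quot mul mu H xi ->
        (\int[mu]_x (sqmod (conv mul inv mu f xi x))%:E
           <= (c ^+ 2)%:E * wnorm2 mu f l s * \int[mu]_x (sqmod (xi x))%:E)%E]].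

Definition group_RD (R : realType) (G : ptopologicalType) (mul : G -> G -> G)
    (inv : G -> G) (e : G) (mu : {measure set (Borel G) -> \bar R}) : Prop :=
  hecke_RD mul inv e mu [set e].

(* Main.v *)
(* (RD) passes from G to (G,H) because left H-invariant functions on G are
   convolved as functions on G; only the length must be changed so that it
   vanishes on H. Put l'(x) = 0 on H and, off H, let l'(x) be the least n such
   that l(hyk) <= n for all h, k in H and all y near x; this is Borel and
   subadditive, and l <= M + l' where M bounds l on H.

   For the converse no Haar measure of H and no modular function is needed. Fix
   a left H-invariant theta >= 0 in C_c(G) with positive integral m, and write
   theta'(x) = theta(x^-1). For f, xi >= 0 set
     f1^2 = f^2 * theta',   F^2 = theta * f1^2,   X^2 = theta * xi^2.
   F is bi-H-invariant and X is left H-invariant. Cauchy-Schwarz with respect to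
   theta(y u^-1) du gives m (f * xi) <= f1 * X; Minkowski gives
   theta * (f1 * X)^2 <= (F * X)^2; and the integral of theta * g is m times the
   integral of g. Hence ||f * xi||^2 <= m^-3 ||F * X||^2, while ||X||^2 = m ||xi||^2
   and ||F||_{l,s} <= const ||f||_{l,s} because l is bounded on the support of
   theta.

   As G need not be sigma-compact or second countable, Tonelli's theorem is only
   used on compact rectangles, on which a continuous function is measurable for
   the product of the Borel sigma-algebras; this is why xi is first cut off to a
   compact set, the general case following by inner regularity. *)
Require Import Defs.
From HB Require Import structures.
From mathcomp Require Import all_boot all_order all_algebra.
From mathcomp Require Import all_classical all_reals all_analysis.
From mathcomp Require Import complex.
From mathcomp Require Import measurable_realfun ring lra.
Set Implicit Arguments.
Unset Strict Implicit.
Unset Printing Implicit Defensive.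
Import Order.TTheory GRing.Theory Num.Theory.
Import numFieldTopology.Exports numFieldNormedType.Exports.
Local Open Scope classical_set_scope.
Local Open Scope ring_scope.

(** * Borel sets and locally compact groups *)

Section borel.
Context (R : realType) (T : ptopologicalType).

Lemma continuous_Borel_measurable (f : T -> R) :
  continuous f -> measurable_fun [set: Borel T] f.
Proof.
move=> cf; apply: (measurability _ (RGenOpens.measurableE R)).
move=> _ [_ [a [b ->] <-]]; rewrite setTI; apply: sub_sigma_algebra.
by move/continuousP : cf; apply; exact: interval_open.
Qed.

Lemma continuous_Borel_measurable_endo (f : T -> T) :
  continuous f -> measurable_fun [set: Borel T] (f : Borel T -> Borel T).
Proof.
move=> cf; apply: (@measurability _ _ (Borel T) (Borel T) setT f (@open T)) => //.
move=> _ [B oB <-]; rewrite setTI; apply: sub_sigma_algebra.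
by move/continuousP : cf; apply.
Qed.

Lemma open_Borel_measurable (U : set T) : open U -> measurable (U : set (Borel T)).
Proof. exact: sub_sigma_algebra. Qed.

Lemma compact_Borel_measurable (K : set T) : hausdorff_space T -> compact K ->
  measurable (K : set (Borel T)).
Proof.
move=> hT /(compact_closed hT) cK; rewrite -(setCK K); apply: measurableC.
by apply: open_Borel_measurable; exact: closed_openC.
Qed.

(** The near-covering form of compactness, applied to the filter of large integers: monotonicity in
    [n] lets each local bound persist along that filter. *)
Lemma compact_locally_bounded_nat (K : set T) (P : nat -> T -> Prop) :
  compact K -> (forall m n x, (m <= n)%N -> P m x -> P n x) ->
  (forall x, K x -> exists n, \forall y \near x, P n y) ->
  exists n, K `<=` P n.
Proof.
move=> /compact_near_coveringP cK monoP locP.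
have [|N _ /(_ N (leqnn _)) KP] := cK nat \oo P _; last by exists N.
move=> x /locP [n Pn]; exists (P n, [set m | (n <= m)%N]); first by split => //; exists n.
by move=> [y m] /= [Pny nm]; exact: monoP Pny.
Qed.

End borel.

Section lcgroup.
Context (R : realType) (G : ptopologicalType).
Context (mul : G -> G -> G) (inv : G -> G) (e : G).
Hypothesis lcG : lc_group mul inv e.
Local Infix "**" := mul (at level 40, left associativity).

Lemma lc_mulA x y z : x ** (y ** z) = x ** y ** z. Proof. by case: lcG. Qed.
Lemma lc_mul1 x : e ** x = x. Proof. by case: lcG => _ /(_ x)[]. Qed.
Lemma lc_mulr1 x : x ** e = x. Proof. by case: lcG => _ /(_ x)[]. Qed.
Lemma lc_mulV x : inv x ** x = e. Proof. by case: lcG => _ _ /(_ x)[]. Qed.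
Lemma lc_mulrV x : x ** inv x = e. Proof. by case: lcG => _ _ /(_ x)[]. Qed.
Lemma lc_mulK y x : x ** y ** inv y = x. Proof. by rewrite -lc_mulA lc_mulrV lc_mulr1. Qed.
Lemma lc_mulVK y x : x ** inv y ** y = x. Proof. by rewrite -lc_mulA lc_mulV lc_mulr1. Qed.
Lemma lc_mulKl y x : inv y ** (y ** x) = x. Proof. by rewrite lc_mulA lc_mulV lc_mul1. Qed.
Lemma lc_mulKVl y x : y ** (inv y ** x) = x. Proof. by rewrite lc_mulA lc_mulrV lc_mul1. Qed.

Lemma lc_inv_uniq x y : x ** y = e -> y = inv x.
Proof. by move=> xy; rewrite -[y](lc_mulKl x) xy lc_mulr1. Qed.
Lemma lc_invM x y : inv (x ** y) = inv y ** inv x.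
Proof. by apply/esym/lc_inv_uniq; rewrite lc_mulA lc_mulK lc_mulrV. Qed.
Lemma lc_invK x : inv (inv x) = x.
Proof. by apply/esym/lc_inv_uniq; rewrite lc_mulV. Qed.

Lemma lc_hausdorff : hausdorff_space G. Proof. by case: lcG => _ _ _ _ []. Qed.

Lemma continuous_mul (T : topologicalType) (f g : T -> G) :
  continuous f -> continuous g -> continuous (fun x => f x ** g x).
Proof.
case: lcG => _ _ _ [cm _] _ cf cg x.
apply: (@continuous_comp _ _ _ (fun x => (f x, g x)) (fun p => p.1 ** p.2)).
  by apply: cvg_pair; [exact: cf|exact: cg].
exact: cm.
Qed.

Lemma continuous_inv (T : topologicalType) (f : T -> G) :
  continuous f -> continuous (fun x => inv (f x)).
Proof.
case: lcG => _ _ _ [_ ci] _ cf x.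
by apply: (@continuous_comp _ _ _ f inv); [exact: cf|exact: ci].
Qed.

Lemma continuous_mulr (y : G) : continuous (fun x => x ** y).
Proof. by apply: continuous_mul => x; [exact: cvg_id|exact: cvg_cst]. Qed.

Lemma continuous_mull (y : G) : continuous (fun x => y ** x).
Proof. by apply: continuous_mul => x; [exact: cvg_cst|exact: cvg_id]. Qed.

Lemma continuous_ldiv (y : G) : continuous (fun x => y ** inv x).
Proof.
apply: continuous_mul; first by move=> x; exact: cvg_cst.
by apply: continuous_inv => x; exact: cvg_id.
Qed.

Lemma continuous_rdiv : continuous (fun p : G * G => p.1 ** inv p.2).
Proof.
apply: continuous_mul; first by move=> x; exact: cvg_fst.
by apply: continuous_inv => x; exact: cvg_snd.
Qed.

Lemma compact_mulset (A B : set G) : compact A -> compact B ->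
  compact [set x | exists2 a, A a & exists2 b, B b & x = a ** b].
Proof.
move=> cA cB; have := @continuous_compact _ _ (fun p : G * G => p.1 ** p.2)
  (A `*` B) _ (compact_setX cA cB).
rewrite (_ : _ @` _ = [set x | exists2 a, A a & exists2 b, B b & x = a ** b]).
  by apply; apply: continuous_subspaceT; case: lcG => _ _ _ [].
apply/seteqP; split=> [_ [[a b] [/= Aa Bb] <-]|_ [a Aa [b Bb ->]]].
  by exists a => //; exists b.
by exists (a, b).
Qed.

Lemma compact_invset (A : set G) : compact A -> compact [set x | A (inv x)].
Proof.
move=> cA; have := @continuous_compact _ _ inv A _ cA.
rewrite (_ : _ @` _ = [set x | A (inv x)]).
  by apply; apply: continuous_subspaceT; case: lcG => _ _ _ [].
apply/seteqP; split=> [_ [a Aa <-]/=|a Aa]; first by rewrite lc_invK.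
by exists (inv a) => //; rewrite lc_invK.
Qed.

Lemma compact_nbhs (x : G) : exists2 K, compact K & nbhs x K.
Proof.
case: lcG => _ _ _ _ [_ /(_ x I)].
by rewrite withinET => -[K Kx [cK _]]; exists K.
Qed.

(** Locally compact Hausdorff spaces are completely regular, so [e] can be separated from the
    complement of the interior of a compact neighbourhood. *)
Lemma bump_function : exists psi : G -> R, [/\ continuous psi,
  exists2 S, compact S & forall x, psi x != 0 -> S x,
  forall x, 0 <= psi x & psi e = 1].
Proof.
have [K cK Ke] := compact_nbhs e.
have [_ _ _ _ [hG lG]] := lcG.
have : uniform_separator [set e] (~` K^°).
  apply: (@locally_compact_completely_regular G R lG hG); last by move/(_ Ke).
  by apply: open_closedC; exact: open_interior.
move=> /(@uniform_separatorP _ R) [f [cf f01 f0 f1]].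
exists (fun x => 1 - f x); split.
- by move=> x; apply: cvgB; [exact: cvg_cst|exact: cf].
- exists K => // x; apply: contra_neqP => nKx; rewrite (f1 (f x)) ?subrr//.
  by exists x => //; move/interior_subset.
- move=> x; rewrite subr_ge0.
  by have /andP[] : f x \in `[0, 1] by apply: f01; exists x.
- by rewrite (f0 (f e)) ?subr0//; exists e.
Qed.

End lcgroup.

(** * Right Haar measure and parametrised integrals *)

Section haar.
Context (R : realType) (G : ptopologicalType).
Context (mul : G -> G -> G) (inv : G -> G) (e : G).
Hypothesis lcG : lc_group mul inv e.
Context (mu : {measure set (Borel G) -> \bar R}).
Hypothesis muG : right_haar mul mu.
Local Infix "**" := mul (at level 40, left associativity).
Implicit Types f g h : G -> R.

Lemma measurable_mulr (F : G -> \bar R) (y : G) :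
  measurable_fun [set: Borel G] F -> measurable_fun [set: Borel G] (fun x => F (x ** y)).
Proof.
move=> mF; apply: (measurableT_comp (f := F : Borel G -> \bar R)
  (g := (fun x => x ** y) : Borel G -> Borel G)) => //.
by apply: continuous_Borel_measurable_endo; exact: (continuous_mulr lcG).
Qed.

(** Change of variables: the push-forward of [mu] under $x \mapsto xy$ is [mu] again, because the
    preimage of $A$ is $Ay^{-1}$. *)
Lemma ge0_integral_mulr (F : G -> \bar R) (y : G) :
  measurable_fun [set: Borel G] F -> (forall x, 0 <= F x)%E ->
  (\int[mu]_x F (x ** y) = \int[mu]_x F x)%E.
Proof.
move=> mF F0; pose phi : Borel G -> Borel G := fun x => x ** y.
have mphi : measurable_fun setT phi.
  by apply: continuous_Borel_measurable_endo; exact: (continuous_mulr lcG).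
have := ge0_integral_pushforward mphi mu measurableT mF (fun x _ => F0 x).
rewrite preimage_setT => <-; apply: eq_measure_integral => A mA _.
change (mu (phi @^-1` A) = mu A).
rewrite (_ : phi @^-1` A = [set x ** inv y | x in A]); first by case: muG => ->.
apply/seteqP; split=> [x Ax|_ [a Aa <-]].
  by exists (x ** y) => //; rewrite (lc_mulK lcG).
by rewrite /phi /= (lc_mulVK lcG).
Qed.

Lemma compact_mu_lty (K : set G) : compact K -> (mu K < +oo)%E.
Proof. by case: muG => _ + _ _ _; apply. Qed.

Lemma cpt_measurable (K : set G) : compact K -> measurable (K : set (Borel G)).
Proof. by apply: compact_Borel_measurable; exact: (lc_hausdorff lcG). Qed.

Lemma compact_bounded_above f (K : set G) : continuous f -> compact K ->
  exists M, 0 <= M /\ forall x, K x -> f x <= M.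
Proof.
move=> cf cK; have [||n Kn] := compact_locally_bounded_nat
  (P := fun n x => f x <= n%:R) cK; last by exists n%:R; split => // x /Kn.
  by move=> m n x mn /le_trans; apply; rewrite ler_nat.
move=> x _; exists (Num.trunc (f x + 1)).+1.
have : \forall y \near x, f y < f x + 1.
  by have /cvgr_lt := cf x; apply; rewrite ltrDl.
apply: filterS => y /ltW /le_trans; apply; apply/ltW.
exact: truncnS_gt.
Qed.

(** A tube argument. Near each point $(x,y)$ both $F(x,y')$ and $F(z,y')$ are within [eps / 2] of
    $F(x,y)$, and compactness of [V] makes the neighbourhood of [x] uniform in [y]. *)
Lemma near_compact_dist (F : G * G -> R) (V : set G) (x : G) (eps : R) :
  continuous F -> compact V -> 0 < eps ->
  \forall z \near x, forall y, V y -> `|F (x, y) - F (z, y)| <= eps.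
Proof.
move=> cF /compact_near_coveringP cV eps0.
apply: (cV G (nbhs x) (fun z y => `|F (x, y) - F (z, y)| <= eps)) => y Vy.
have e20 : 0 < eps / 2 by rewrite divr_gt0.
have : \forall p \near (x, y), `|F (x, y) - F p| < eps / 2.
  by have /cvgrPdist_lt := cF (x, y); exact.
case=> -[A B] /= [Ax By] AB; exists (B, A) => // -[y' z] /= [By' Az].
have h1 := AB (x, y') (conj (nbhs_singleton Ax) By').
have h2 := AB (z, y') (conj Az By').
rewrite -(subrKA (F (x, y))) (le_trans (ler_normD _ _))//.
by rewrite (splitr eps) lerD// ?(distrC _ (F (x, y))) ltW.
Qed.

(** * Continuity of integrals depending on a parameter *)

Section param.
Variables (F : G * G -> R) (V : set G) (g : G -> R).
Hypotheses (cF : continuous F) (F0 : forall p, 0 <= F p) (cV : compact V).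
Hypotheses (mg : measurable_fun [set: Borel G] g) (g0 : forall y, 0 <= g y).
Hypotheses (gV : forall y, ~ V y -> g y = 0) (goo : (\int[mu]_y (g y)%:E < +oo)%E).

Let cFl x : continuous (fun y => F (x, y)).
Proof.
move=> y; apply: (@continuous_comp _ _ _ (fun y => (x, y)) F); last exact: cF.
by apply: cvg_pair; [exact: cvg_cst|exact: cvg_id].
Qed.

Lemma measurable_param x : measurable_fun [set: Borel G] (fun y => (F (x, y) * g y)%:E).
Proof.
apply/measurable_EFinP; apply: measurable_funM => //.
exact: continuous_Borel_measurable.
Qed.

Lemma param_integral_lty x : (\int[mu]_y (F (x, y) * g y)%:E < +oo)%E.
Proof.
have [M [M0 FM]] := compact_bounded_above (@cFl x) cV.
apply: (@le_lt_trans _ _ (\int[mu]_y (M%:E * (g y)%:E))%E).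
  apply: ge0_le_integral => //.
  - by move=> y _; rewrite lee_fin mulr_ge0.
  - exact: measurable_param.
  - by apply: measurable_funeM; exact/measurable_EFinP.
  - move=> y _; rewrite -EFinM lee_fin.
    have [Vy|/gV ->] := pselect (V y); last by rewrite !mulr0.
    by rewrite ler_wpM2r// FM.
rewrite ge0_integralZl//; last 2 first.
  - exact/measurable_EFinP.
  - by move=> y _; rewrite lee_fin.
by rewrite lte_mul_pinfty.
Qed.

(** Sequential dominated convergence would not give continuity on a space that may fail to be first
    countable. Instead the integrand varies uniformly on [V], so the integral changes by at most
    [eps] times the integral [c] of [g]. *)
Lemma continuous_param_integral :
  continuous (fun x => fine (\int[mu]_y (F (x, y) * g y)%:E)%E).
Proof.
set I := fun x => fine _.
have IE x : (\int[mu]_y (F (x, y) * g y)%:E)%E = (I x)%:E.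
  rewrite fineK// ge0_fin_numE; first exact: param_integral_lty.
  by apply: integral_ge0 => y _; rewrite lee_fin mulr_ge0.
pose c := fine (\int[mu]_y (g y)%:E)%E.
have cE : (\int[mu]_y (g y)%:E)%E = c%:E.
  by rewrite fineK// ge0_fin_numE//; apply: integral_ge0 => y _; rewrite lee_fin.
have c0 : 0 <= c by apply: fine_ge0; apply: integral_ge0 => y _; rewrite lee_fin.
have key x z eps : 0 <= eps -> (forall y, V y -> `|F (x, y) - F (z, y)| <= eps) ->
    I x <= I z + eps * c.
  move=> eps0 H; rewrite -lee_fin EFinD EFinM -!IE -cE -ge0_integralZl//; last 2 first.
    - exact/measurable_EFinP.
    - by move=> y _; rewrite lee_fin.
  rewrite -ge0_integralD//; last 4 first.
    - by move=> y _; rewrite lee_fin mulr_ge0.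
    - exact: measurable_param.
    - by move=> y _; rewrite -EFinM lee_fin mulr_ge0.
    - by apply: measurable_funeM; exact/measurable_EFinP.
  apply: ge0_le_integral => //.
  - by move=> y _; rewrite lee_fin mulr_ge0.
  - exact: measurable_param.
  - apply: emeasurable_funD; first exact: measurable_param.
    by apply: measurable_funeM; exact/measurable_EFinP.
  - move=> y _; rewrite -EFinM -EFinD lee_fin.
    have [Vy|/gV ->] := pselect (V y); last by rewrite !mulr0 addr0.
    rewrite -mulrDl ler_wpM2r// -lerBlDl.
    by apply: le_trans (H y Vy); exact: ler_norm.
move=> x; apply/cvgrPdist_le => eps eps0.
(* The denominator is [c + 1] because [c] may be zero. *)
have d0 : 0 < eps / (c + 1) by rewrite divr_gt0// ltr_wpDl.
have dc : eps / (c + 1) * c <= eps.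
  by rewrite mulrAC ler_pdivrMr ?ltr_wpDl// ler_pM2l// lerDl.
have := near_compact_dist x cF cV d0; apply: filterS => z Hz.
rewrite ler_norml lerBlDl lerNl opprB lerBlDl.
have h1 := key _ _ _ (ltW d0) Hz.
have h2 : I z <= I x + eps / (c + 1) * c.
  by apply: key; [exact: ltW|move=> y /Hz; rewrite distrC].
by apply/andP; split; [apply: le_trans h2 _|apply: le_trans h1 _]; rewrite lerD2l.
Qed.

End param.

Definition locally_integrable g := forall K : set G, compact K ->
  (\int[mu]_(y in K) (g y)%:E < +oo)%E.

Definition econvol f g (x : G) : \bar R := (\int[mu]_y (f (x ** inv y) * g y)%:E)%E.

(** [fine] sends an infinite value to 0; [convolE] recovers the true integral when [f] is in $C_c$
    and [g] is locally integrable. *)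
Definition convol f g (x : G) : R := fine (econvol f g x).

Definition nonneg_Cc f := [/\ continuous f, (forall x, 0 <= f x) &
  exists2 S : set G, compact S & forall x, f x != 0 -> S x].

Definition nonneg_Borel g := measurable_fun [set: Borel G] g /\ forall x, 0 <= g x.

End haar.

(** * Tonelli's theorem on compact rectangles, and convolution *)

Section product_measurability.
Context (R : realType) (T : ptopologicalType).

(** [C] is covered by finitely many open boxes inside [O], and such a union lies in the product of
    the Borel sigma-algebras. The choice of boxes is encoded by a filter on the measurable subsets
    of [O], directed by inclusion through finite unions. *)
Lemma compact_box_separation (C O : set (T * T)) :
  compact C -> open O -> C `<=` O ->
  exists M : set (Borel T * Borel T), [/\ measurable M, C `<=` M & M `<=` O].
Proof.
move=> /compact_near_coveringP cC oO CO.
pose D := [set M : set (Borel T * Borel T) | measurable M /\ M `<=` O].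
pose F := filter_from D (fun M => [set N | D N /\ M `<=` N]).
have FF : Filter F.
  apply: filter_from_filter; first by exists set0; split.
  move=> M N [mM MO] [mN NO]; exists (M `|` N).
    by split; [exact: measurableU|rewrite subUset].
  by move=> Q [DQ]; rewrite subUset => -[MQ NQ].
have [p Cp|M [mM MO] MC] := cC _ F (fun (M : set (Borel T * Borel T)) p => M p) FF.
  have [[A B] /= [Ap Bp] ABO] : nbhs p O by apply: open_nbhs_nbhs; split => //; exact: CO.
  exists ((A^° `*` B^°), [set N | D N /\ (A^° `*` B^°) `<=` N]).
    split; first by exists (A^°, B^°) => //; split; exact: nbhs_interior.
    exists (A^° `*` B^°) => //; split; last first.
      by move=> q [/interior_subset ? /interior_subset ?]; exact: ABO.
    by apply: measurableX; apply: open_Borel_measurable; exact: open_interior.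
  by move=> [q N] /= [ABq [_]]; exact.
by exists M; split => //; apply: (MC M); split.
Qed.

(** On the rectangle, the set where $F > a$ is the union of the compact sets where $F \ge a +
    1/(n+1)$. Each of these is enclosed in a product-measurable set still contained in $F > a$, so
    the union of these sets, cut to the rectangle, is exactly the required set. *)
Lemma measurable_fun_compact_rect (F : T * T -> R) (Y L : set T) :
  hausdorff_space T -> continuous F -> compact Y -> compact L ->
  measurable_fun ((Y `*` L) : set (Borel T * Borel T)) F.
Proof.
move=> hT cF cY cL mD.
apply: (measurability _ (RGenOInfty.measurableE R)) => //.
move=> _ [_ [a ->] <-].
pose C n := [set p | (Y `*` L) p /\ a + n.+1%:R^-1 <= F p].
pose O := [set p | a < F p].
have oO : open O by move/continuousP : cF => /(_ _ (@open_gt _ a)).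
have cC n : compact (C n).
  rewrite (_ : C n = (Y `*` L) `&` [set p | a + n.+1%:R^-1 <= F p])//.
  apply: compact_closedI; first exact: compact_setX.
  by move/continuous_closedP : cF => /(_ _ (@closed_ge _ (a + n.+1%:R^-1))).
have CO n : C n `<=` O.
  by move=> p [_]; apply: lt_le_trans; rewrite ltrDl invr_gt0.
have /choice[M MP] n := compact_box_separation (cC n) oO (@CO n).
rewrite (_ : _ `&` _ = \bigcup_n ((Y `*` L) `&` M n)).
  by apply: bigcupT_measurable => n; apply: measurableI => //; have [] := MP n.
apply/seteqP; split=> [p [/= Dp]|p [n _ [Dp Mp]]].
  rewrite in_itv/= andbT => aF; exists (Num.trunc (F p - a)^-1) => //; split => //.
  have [_ CM _] := MP (Num.trunc (F p - a)^-1); apply: CM; split => //.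
  have Fa : 0 < F p - a by rewrite subr_gt0.
  rewrite -lerBrDl -[leRHS]invrK lef_pV2 ?posrE ?invr_gt0//.
  by apply/ltW; exact: truncnS_gt.
by split => //=; rewrite in_itv/= andbT; have [_ _ MO] := MP n; exact: MO.
Qed.

End product_measurability.

Section restriction.
Context d (T : measurableType d) (R : realType) (mu : {measure set T -> \bar R}).
Context (D : set T) (mD : measurable D) (muD : (mu D < +oo)%E).

(** Allows [mu], which may fail to be sigma-finite, to be replaced by a finite measure before
    Tonelli's theorem is applied. *)
Lemma integral_mfrestr (f : T -> \bar R) : (forall x, ~ D x -> f x = 0%E) ->
  (\int[mu]_x f x = \int[mfrestr mD muD]_x f x)%E.
Proof.
move=> fD; have -> : f = f \_ D.
  by apply/funext => x; rewrite patchE; case: ifPn => // /negP; rewrite inE => /fD.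
rewrite -!integral_mkcond; apply: eq_measure_integral => A mA AD.
by change (mu A = mu (A `&` D)); rewrite (setIidl AD).
Qed.

End restriction.

Section convolution.
Context (R : realType) (G : ptopologicalType).
Context (mul : G -> G -> G) (inv : G -> G) (e : G).
Hypothesis lcG : lc_group mul inv e.
Context (mu : {measure set (Borel G) -> \bar R}).
Hypothesis muG : right_haar mul mu.
Local Infix "**" := mul (at level 40, left associativity).
Local Notation econvol := (econvol mul inv mu).
Local Notation convol := (convol mul inv mu).
Local Notation locally_integrable := (locally_integrable mu).
Implicit Types f g h k : G -> R.

Lemma tonelli_compact (F : G * G -> R) (Y L : set G) (g k : G -> R) :
  continuous F -> (forall p, 0 <= F p) -> compact Y -> compact L ->
  nonneg_Borel g -> nonneg_Borel k -> (forall u, ~ L u -> g u = 0) -> (forall y, ~ Y y -> k y = 0) ->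
  (\int[mu]_y \int[mu]_u (F (y, u) * g u * k y)%:E =
   \int[mu]_u \int[mu]_y (F (y, u) * g u * k y)%:E)%E.
Proof.
move=> cF F0 cY cL [mg g0] [mk k0] gL kY.
have mY := cpt_measurable lcG cY; have mL := cpt_measurable lcG cL.
have Yoo := compact_mu_lty muG cY; have Loo := compact_mu_lty muG cL.
pose D : set (Borel G * Borel G) := Y `*` L.
have mD : measurable D by exact: measurableX.
(* [F] is replaced by its restriction to the rectangle, where its product measurability is known;
   the integrand is unchanged because [g] and [k] vanish outside [L] and [Y]. *)
pose h (p : Borel G * Borel G) : \bar R := ((F \_ D) p * g p.2 * k p.1)%:E.
have hE y u : h (y, u) = (F (y, u) * g u * k y)%:E.
  rewrite /h patchE; case: ifPn => //= /negP; rewrite inE => nD.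
  rewrite !mul0r; have [Yy|/kY ->] := pselect (Y y); last by rewrite mulr0.
  by have [Lu|/gL ->] := pselect (L u); [case: nD|rewrite mulr0 mul0r].
have mh : measurable_fun setT h.
  apply/measurable_EFinP; apply: measurable_funM; last first.
    by apply: (measurableT_comp (f := k : Borel G -> R)) => //; exact: measurable_fst.
  apply: measurable_funM; last first.
    by apply: (measurableT_comp (f := g : Borel G -> R)) => //; exact: measurable_snd.
  apply/(measurable_restrictT _ mD).
  by apply: measurable_fun_compact_rect => //; exact: (lc_hausdorff lcG).
have h0 p : (0 <= h p)%E.
  by case: p => y u; rewrite hE lee_fin mulr_ge0// mulr_ge0.
have := fubini_tonelli (m1 := mfrestr mY Yoo) (m2 := mfrestr mL Loo) h mh h0.
rewrite -(integral_mfrestr mY Yoo); last first.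
  move=> y /kY ky; apply: integral0_eq => u _; by rewrite hE ky mulr0.
rewrite -(integral_mfrestr mL Loo); last first.
  move=> u /gL gu; apply: integral0_eq => y _; by rewrite hE gu mulr0 mul0r.
under eq_integral => y _.
  rewrite -(integral_mfrestr mL Loo); last by move=> u /gL gu; rewrite hE gu mulr0 mul0r.
  under eq_integral do rewrite hE.
  over.
move=> ->; apply: eq_integral => u _.
rewrite -(integral_mfrestr mY Yoo); last by move=> y /kY ky; rewrite hE ky mulr0.
by under eq_integral do rewrite hE.
Qed.

Lemma Cc_nonnegB f : nonneg_Cc f -> nonneg_Borel f.
Proof. by case=> cf f0 _; split => //; exact: continuous_Borel_measurable. Qed.

Lemma nonnegBM f g : nonneg_Borel f -> nonneg_Borel g -> nonneg_Borel (fun x => f x * g x).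
Proof. by move=> [mf f0] [mg g0]; split; [exact: measurable_funM|move=> x; exact: mulr_ge0]. Qed.

Lemma nonnegB_indic (A : set G) : measurable (A : set (Borel G)) -> nonneg_Borel (\1_A : G -> R).
Proof. by move=> mA; split => // x; rewrite indicE. Qed.

Lemma Cc_rdiv f (x : G) : nonneg_Cc f -> nonneg_Borel (fun y => f (x ** inv y)).
Proof.
case=> cf f0 _; split => //; apply: continuous_Borel_measurable => y.
apply: (@continuous_comp _ _ _ (fun y => x ** inv y) f); last exact: cf.
exact: (continuous_ldiv lcG).
Qed.

Lemma Cc_ldiv f (u : G) : nonneg_Cc f -> nonneg_Borel (fun y => f (y ** inv u)).
Proof.
case=> cf f0 _; split => //; apply: continuous_Borel_measurable => y.
apply: (@continuous_comp _ _ _ (fun y => y ** inv u) f); last exact: cf.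
exact: (continuous_mulr lcG).
Qed.

Lemma nonnegB_E f : nonneg_Borel f -> measurable_fun [set: Borel G] (EFin \o f).
Proof. by case=> mf _; exact/measurable_EFinP. Qed.

Lemma nonnegBZ (c : R) f : 0 <= c -> nonneg_Borel f -> nonneg_Borel (fun x => c * f x).
Proof. by move=> c0; apply: nonnegBM; split => //; exact: measurable_cst. Qed.

Lemma nonnegB_integralZl (c : R) f : 0 <= c -> nonneg_Borel f ->
  (\int[mu]_x (c * f x)%:E = c%:E * \int[mu]_x (f x)%:E)%E.
Proof.
move=> c0 nf; have [mf f0] := nf; rewrite -ge0_integralZl//; first exact: nonnegB_E.
by move=> x _; rewrite lee_fin.
Qed.

Lemma nonnegB_le_integral f g : nonneg_Borel f -> nonneg_Borel g -> (forall x, f x <= g x) ->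
  (\int[mu]_x (f x)%:E <= \int[mu]_x (g x)%:E)%E.
Proof.
move=> nf ng fg; apply: ge0_le_integral => //; try exact: nonnegB_E.
- by move=> x _; rewrite lee_fin; case: nf.
- by move=> x _; rewrite lee_fin fg.
Qed.

Lemma nonnegB_integral_ge0 f : nonneg_Borel f -> (0 <= \int[mu]_x (f x)%:E)%E.
Proof. by move=> [_ f0]; apply: integral_ge0 => x _; rewrite lee_fin. Qed.

Lemma Cc_rdiv2 f : nonneg_Cc f -> continuous (fun p : G * G => f (p.1 ** inv p.2)).
Proof.
case=> cf _ _ p; apply: (@continuous_comp _ _ _ (fun p => p.1 ** inv p.2) f); last exact: cf.
exact: (continuous_rdiv lcG).
Qed.

(** The integrand vanishes unless $y \in SL$, with $S$ the support bound of [f]. This set is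
    compact, so [k] may be multiplied by its indicator and the rectangle version applies. *)
Lemma conv_tonelli f g k (L : set G) : nonneg_Cc f -> nonneg_Borel g -> nonneg_Borel k -> compact L ->
  (forall u, ~ L u -> g u = 0) ->
  (\int[mu]_y \int[mu]_u (f (y ** inv u) * g u * k y)%:E =
   \int[mu]_u \int[mu]_y (f (y ** inv u) * g u * k y)%:E)%E.
Proof.
move=> nf ng nk cL gL; have [cf f0 [S cS fS]] := nf.
pose Y := [set x | exists2 a, S a & exists2 b, L b & x = a ** b].
have cY : compact Y by exact: (compact_mulset lcG).
have HE y u : f (y ** inv u) * g u * k y =
    f (y ** inv u) * g u * (k y * \1_Y y).
  have [/eqP gu|gu] := boolP (g u == 0); first by rewrite gu mulr0 !mul0r.
  have Lu : L u by apply: contrapT => /gL /eqP; exact/negP.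
  have [/eqP fu|/fS Sy] := boolP (f (y ** inv u) == 0); first by rewrite fu !mul0r.
  rewrite indicE mem_set ?mulr1//; exists (y ** inv u) => //.
  by exists u => //; rewrite (lc_mulVK lcG).
under eq_integral do under eq_integral do rewrite HE.
under [RHS]eq_integral do under eq_integral do rewrite HE.
apply: (tonelli_compact (F := fun p => f (p.1 ** inv p.2)) (Y := Y) (L := L)) => //.
- exact: Cc_rdiv2.
- by apply: nonnegBM => //; apply: nonnegB_indic; exact: (cpt_measurable lcG).
- by move=> y nY; rewrite indicE memNset// mulr0.
Qed.

Lemma econvol_ge0 f g x : nonneg_Cc f -> nonneg_Borel g -> (0 <= econvol f g x)%E.
Proof.
move=> [_ f0 _] [_ g0]; apply: integral_ge0 => y _.
by rewrite lee_fin mulr_ge0.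
Qed.

(** If $xy^{-1} \in S$ and $x \in N$, then $y \in S^{-1}N$. Hence the values of a convolution on [N]
    only involve the second factor on a compact set. *)
Lemma econvol_localize f (N : set G) : nonneg_Cc f -> compact N ->
  exists2 V : set G, compact V & forall x, N x -> forall y, f (x ** inv y) != 0 -> V y.
Proof.
move=> [_ _ [S cS fS]] cN.
exists [set x | exists2 a, S (inv a) & exists2 b, N b & x = a ** b].
  by apply: (compact_mulset lcG) => //; exact: (compact_invset lcG).
move=> x Nx y /fS Sxy; exists (inv (x ** inv y)); first by rewrite (lc_invK lcG).
by exists x => //; rewrite (lc_invM lcG) (lc_invK lcG) (lc_mulVK lcG).
Qed.

Lemma integral_indic_mul g (V : set G) : measurable (V : set (Borel G)) ->
  (\int[mu]_y (g y * \1_V y)%:E = \int[mu]_(y in V) (g y)%:E)%E.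
Proof.
move=> mV; rewrite [RHS]integral_mkcond; apply: eq_integral => y _.
by rewrite patchE indicE; case: ifPn => _; rewrite ?mulr1 ?mulr0.
Qed.

(** Both claims are local in [x]: on a compact neighbourhood of [x], [g] may be cut off to a compact
    set, where it is integrable, and the results on parametrised integrals apply. *)
Lemma econvol_finite_continuous f g : nonneg_Cc f -> nonneg_Borel g -> locally_integrable g ->
  (forall x, (econvol f g x < +oo)%E) /\ continuous (convol f g).
Proof.
move=> nf ng lg.
have H (x : G) : (econvol f g x < +oo)%E /\ convol f g z @[z --> x] --> convol f g x.
  have [N cN Nx] := compact_nbhs lcG x.
  have [V cV NV] := econvol_localize nf cN.
  have mV := cpt_measurable lcG cV.
  have [mg' g'0] := nonnegBM ng (nonnegB_indic mV).
  have g'V y : ~ V y -> g y * \1_V y = 0 by move=> nV; rewrite indicE memNset// mulr0.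
  have g'oo : (\int[mu]_y (g y * \1_V y)%:E < +oo)%E.
    by rewrite integral_indic_mul//; exact: lg.
  have [_ f0 _] := nf.
  have cF := Cc_rdiv2 nf.
  have F0 : forall p : G * G, 0 <= f (p.1 ** inv p.2) by [].
  have E z : N z -> econvol f g z = (\int[mu]_y (f (z ** inv y) * (g y * \1_V y))%:E)%E.
    move=> Nz; apply: eq_integral => y _; congr _%:E.
    have [->|/(NV _ Nz) Vy] := eqVneq (f (z ** inv y)) 0; first by rewrite !mul0r.
    by rewrite indicE mem_set// mulr1.
  split.
    rewrite (E x (nbhs_singleton Nx)).
    exact: (param_integral_lty cF F0 cV mg' g'0 g'V g'oo).
  have := @continuous_param_integral _ _ _ _ _ _ cF F0 cV mg' g'0 g'V g'oo x.
  rewrite /convol (E x (nbhs_singleton Nx)).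
  apply: cvg_trans; apply: near_eq_cvg.
  by apply: filterS Nx => z Nz; rewrite E.
by split=> [x|x]; [have [] := H x|have [] := H x].
Qed.

End convolution.

(** * Inequalities for convolutions *)

(** Integrate $wuv \le \frac t2 wu^2 + \frac1{2t} wv^2$, which is $(tu-v)^2 \ge 0$ up to a factor,
    and then choose $t > 0$. *)
Lemma cauchy_schwarz_weighted d (T : measurableType d) (R : realType)
    (mu : {measure set T -> \bar R}) (w u v : T -> R) (A B : R) :
  measurable_fun setT w -> measurable_fun setT u -> measurable_fun setT v ->
  (forall x, 0 <= w x) -> (forall x, 0 <= u x) -> (forall x, 0 <= v x) ->
  (\int[mu]_x (w x * u x ^+ 2)%:E = A%:E)%E ->
  (\int[mu]_x (w x * v x ^+ 2)%:E = B%:E)%E ->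
  (\int[mu]_x (w x * u x * v x)%:E <= (Num.sqrt A * Num.sqrt B)%:E)%E.
Proof.
move=> mw mu' mv w0 u0 v0 EA EB.
have A0 : 0 <= A.
  by rewrite -lee_fin -EA; apply: integral_ge0 => x _; rewrite lee_fin mulr_ge0// exprn_ge0.
have B0 : 0 <= B.
  by rewrite -lee_fin -EB; apply: integral_ge0 => x _; rewrite lee_fin mulr_ge0// exprn_ge0.
set I := (\int[mu]_x _)%E.
have I0 : (0 <= I)%E.
  by apply: integral_ge0 => x _; rewrite lee_fin mulr_ge0// mulr_ge0.
have mwu : measurable_fun setT (fun x => (w x * u x ^+ 2)%:E).
  by apply/measurable_EFinP; apply: measurable_funM => //; exact: measurable_funX.
have mwv : measurable_fun setT (fun x => (w x * v x ^+ 2)%:E).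
  by apply/measurable_EFinP; apply: measurable_funM => //; exact: measurable_funX.
have It (t : R) : 0 < t -> (I <= (t / 2 * A + t^-1 / 2 * B)%:E)%E.
  move=> t0; have t20 : 0 <= t / 2 by rewrite divr_ge0// ltW.
  have t2V0 : 0 <= t^-1 / 2 by rewrite divr_ge0// invr_ge0 ltW.
  rewrite EFinD !EFinM -EA -EB -!ge0_integralZl//; last 2 first.
  - by move=> x _; rewrite lee_fin mulr_ge0// exprn_ge0.
  - by move=> x _; rewrite lee_fin mulr_ge0// exprn_ge0.
  rewrite -ge0_integralD//; last 4 first.
  - by move=> x _; rewrite -EFinM lee_fin mulr_ge0// mulr_ge0// sqr_ge0.
  - exact: measurable_funeM.
  - by move=> x _; rewrite -EFinM lee_fin mulr_ge0// mulr_ge0// sqr_ge0.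
  - exact: measurable_funeM.
  apply: ge0_le_integral => //.
  - by move=> x _; rewrite lee_fin mulr_ge0// mulr_ge0.
  - by apply/measurable_EFinP; apply: measurable_funM => //; exact: measurable_funM.
  - by apply: emeasurable_funD; exact: measurable_funeM.
  move=> x _; rewrite -!EFinM -EFinD lee_fin -subr_ge0.
  rewrite (_ : _ - _ = w x / 2 * t^-1 * (t * u x - v x) ^+ 2).
    by rewrite mulr_ge0 ?sqr_ge0// mulr_ge0 ?invr_ge0 ?(ltW t0)// divr_ge0.
  by field; rewrite gt_eqF.
have Ifin : I \is a fin_num.
  by rewrite ge0_fin_numE// (le_lt_trans (It 1 ltr01))// ltry.
rewrite -(fineK Ifin) lee_fin -sqrtrM//.
set c := fine I; have c0 : 0 <= c by exact: fine_ge0.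
have ct (t : R) : 0 < t -> c <= t / 2 * A + t^-1 / 2 * B.
  by move=> t0; rewrite -lee_fin fineK// It.
rewrite -(ger0_norm c0) -sqrtr_sqr; apply: ler_wsqrtr.
move: c0; rewrite le_eqVlt => /orP[/eqP <-|c0]; first by rewrite expr0n mulr_ge0.
move: A0; rewrite le_eqVlt => /orP[/eqP A0|A0].
  (* For $A = 0$ and $c > 0$ this [t] gives $c \le cB/(2(B+1)) < c$, a contradiction. *)
  have t0 : 0 < (B + 1) / c by rewrite divr_gt0// ltr_wpDl.
  have := ct _ t0; rewrite -A0 mulr0 add0r invf_div.
  have b1 : 0 < B + 1 by rewrite ltr_wpDl.
  rewrite -[X in X <= _]mul1r (_ : c / (B + 1) / 2 * B = B / (B + 1) / 2 * c); last first.
    by field; rewrite gt_eqF.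
  rewrite ler_pM2r// ler_pdivlMr// ler_pdivlMr// => h.
  by exfalso; move: h; apply/negP; rewrite -ltNge; lra.
(* For $A > 0$ this [t] gives $c^2 \le c^2/2 + AB/2$, that is $c^2 \le AB$. *)
have t0 : 0 < c / A by rewrite divr_gt0.
have := ct _ t0; rewrite invf_div -(ler_pM2l c0) -expr2.
have -> : c * (c / A / 2 * A + A / c / 2 * B) = c ^+ 2 / 2 + A * B / 2.
  by field; rewrite !gt_eqF.
lra.
Qed.

Section convolution_inequalities.
Context (R : realType) (G : ptopologicalType).
Context (mul : G -> G -> G) (inv : G -> G) (e : G).
Hypothesis lcG : lc_group mul inv e.
Context (mu : {measure set (Borel G) -> \bar R}).
Hypothesis muG : right_haar mul mu.
Local Infix "**" := mul (at level 40, left associativity).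
Local Notation econvol := (econvol mul inv mu).
Local Notation convol := (convol mul inv mu).
Local Notation locally_integrable := (locally_integrable mu).
Implicit Types f g h k : G -> R.

Lemma Cc_support f : nonneg_Cc f ->
  exists2 L : set G, compact L & forall u, ~ L u -> f u = 0.
Proof.
by case=> _ _ [S cS fS]; exists S => // u nSu; apply: contra_notP nSu => /eqP/fS.
Qed.

Lemma Cc_sqr f : nonneg_Cc f -> nonneg_Cc (fun x => f x ^+ 2).
Proof.
case=> cf f0 [S cS fS]; split.
- by move=> x; apply: cvgM; exact: cf.
- by move=> x; rewrite exprn_ge0.
- by exists S => // x; rewrite expf_eq0/= => /fS.
Qed.

Lemma Cc_sqrt f : nonneg_Cc f -> nonneg_Cc (fun x => Num.sqrt (f x)).
Proof.
case=> cf f0 [S cS fS]; split.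
- by move=> x; apply: (@continuous_comp _ _ _ f Num.sqrt); [exact: cf|exact: sqrt_continuous].
- by move=> x; rewrite sqrtr_ge0.
- by exists S => // x fx; apply: fS; apply: contra fx => /eqP ->; rewrite sqrtr0.
Qed.

Lemma Cc_inv f : nonneg_Cc f -> nonneg_Cc (fun x => f (inv x)).
Proof.
case=> cf f0 [S cS fS]; split => //.
- move=> x; apply: (@continuous_comp _ _ _ inv f); last exact: cf.
  by apply: (continuous_inv lcG) => y; exact: cvg_id.
- by exists [set x | S (inv x)]; [exact: (compact_invset lcG)|move=> x /fS].
Qed.

Lemma nonnegB_sqr g : nonneg_Borel g -> nonneg_Borel (fun x => g x ^+ 2).
Proof. by move=> ng; exact: (nonnegBM ng ng). Qed.

Lemma locally_integrable_integrable g : nonneg_Borel g -> (\int[mu]_x (g x)%:E < +oo)%E -> locally_integrable g.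
Proof.
move=> [mg g0] goo K cK; apply: le_lt_trans goo.
apply: ge0_subset_integral => //; first exact: (cpt_measurable lcG).
  exact/measurable_EFinP.
by move=> x _; rewrite lee_fin.
Qed.

Lemma Cc_integral_lty f : nonneg_Cc f -> (\int[mu]_x (f x)%:E < +oo)%E.
Proof.
move=> nf; have [cf f0 [S cS fS]] := nf; have mS := cpt_measurable lcG cS.
have [M [M0 fM]] := compact_bounded_above cf cS.
apply: (@le_lt_trans _ _ (\int[mu]_x (M%:E * (\1_S x)%:E))%E).
  apply: ge0_le_integral => //.
  - by move=> y _; rewrite lee_fin.
  - by apply: nonnegB_E; exact: Cc_nonnegB.
  - apply: measurable_funeM; apply/measurable_EFinP.
    exact: measurable_indic.
  - move=> y _; rewrite -EFinM lee_fin indicE.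
    have [/eqP ->|/fS Sy] := boolP (f y == 0); first by rewrite mulr_ge0.
    by rewrite mem_set// mulr1 fM.
rewrite ge0_integralZl//; last by apply/measurable_EFinP; exact: measurable_indic.
rewrite integral_indic// setIT lte_mul_pinfty//.
exact: (compact_mu_lty muG).
Qed.

Lemma Cc_locally_integrable f : nonneg_Cc f -> locally_integrable f.
Proof.
by move=> nf; apply: locally_integrable_integrable; [exact: Cc_nonnegB|exact: Cc_integral_lty].
Qed.

Lemma Cc_integralE f : nonneg_Cc f ->
  (\int[mu]_x (f x)%:E)%E = (fine (\int[mu]_x (f x)%:E)%E)%:E.
Proof.
move=> nf; rewrite fineK// ge0_fin_numE; first exact: Cc_integral_lty.
by apply: integral_ge0 => x _; rewrite lee_fin; case: nf.
Qed.

Lemma convolE f g x : nonneg_Cc f -> nonneg_Borel g -> locally_integrable g -> econvol f g x = (convol f g x)%:E.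
Proof.
move=> nf ng lg; rewrite /convol fineK// ge0_fin_numE; last exact: econvol_ge0.
by have [] := econvol_finite_continuous lcG nf ng lg.
Qed.

Lemma convol_ge0 f g x : nonneg_Cc f -> nonneg_Borel g -> 0 <= convol f g x.
Proof. by move=> nf ng; apply: fine_ge0; exact: econvol_ge0. Qed.

Lemma nonnegB_convol f g : nonneg_Cc f -> nonneg_Borel g -> locally_integrable g -> nonneg_Borel (convol f g).
Proof.
move=> nf ng lg; split; last by move=> x; exact: convol_ge0.
apply: continuous_Borel_measurable.
by have [] := econvol_finite_continuous lcG nf ng lg.
Qed.

Lemma Cc_convol f g (L : set G) : nonneg_Cc f -> nonneg_Borel g -> locally_integrable g -> compact L ->
  (forall u, ~ L u -> g u = 0) -> nonneg_Cc (convol f g).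
Proof.
move=> nf ng lg cL gL; have [_ _ [S cS fS]] := nf; split.
- by have [] := econvol_finite_continuous lcG nf ng lg.
- by move=> x; exact: convol_ge0.
exists [set x | exists2 a, S a & exists2 b, L b & x = a ** b].
  exact: (compact_mulset lcG).
move=> x; apply: contra_neqP => nx; rewrite /convol /econvol integral0_eq// => y _.
have [->|/fS Sxy] := eqVneq (f (x ** inv y)) 0; first by rewrite mul0r.
rewrite gL ?mulr0// => Ly; apply: nx; exists (x ** inv y) => //; exists y => //.
by rewrite (lc_mulVK lcG).
Qed.

Lemma integral_rdiv f (u : G) : nonneg_Cc f ->
  (\int[mu]_y (f (y ** inv u))%:E = \int[mu]_y (f y)%:E)%E.
Proof.
move=> nf; have [mf f0] := Cc_nonnegB nf.
apply: (ge0_integral_mulr lcG muG (F := fun y => (f y)%:E)) => [|x].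
  exact/measurable_EFinP.
by rewrite lee_fin.
Qed.

(** Tonelli with [k] equal to 1, after which the inner integral of $f(yu^{-1})$ over $y$ is
    independent of $u$ by right invariance. *)
Lemma integral_econvol f g (L : set G) : nonneg_Cc f -> nonneg_Borel g -> compact L ->
  (forall u, ~ L u -> g u = 0) ->
  (\int[mu]_y econvol f g y = \int[mu]_x (f x)%:E * \int[mu]_x (g x)%:E)%E.
Proof.
move=> nf ng cL gL; have n1 : nonneg_Borel (fun _ : G => 1 : R).
  by split=> //; exact: measurable_cst.
have := conv_tonelli lcG muG nf ng n1 cL gL.
under eq_integral do under eq_integral do rewrite mulr1.
move=> ->; rewrite (Cc_integralE nf) -ge0_integralZl//; last 3 first.
- exact: nonnegB_E.
- by move=> x _; rewrite lee_fin; case: ng.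
- by rewrite lee_fin fine_ge0// integral_ge0// => x _; rewrite lee_fin; case: nf.
apply: eq_integral => u _; rewrite -Cc_integralE//.
have [mg g0] := ng.
under eq_integral do rewrite mulr1 mulrC EFinM.
rewrite ge0_integralZl//; last 3 first.
- by apply: nonnegB_E; exact: (Cc_ldiv lcG).
- by move=> x _; rewrite lee_fin; case: nf.
- by rewrite lee_fin.
by rewrite integral_rdiv// muleC.
Qed.

End convolution_inequalities.

(** * Quadratic averages against a fixed function of compact support *)

Section averaging.
Context (R : realType) (G : ptopologicalType).
Context (mul : G -> G -> G) (inv : G -> G) (e : G).
Hypothesis lcG : lc_group mul inv e.
Context (mu : {measure set (Borel G) -> \bar R}).
Hypothesis muG : right_haar mul mu.
Local Infix "**" := mul (at level 40, left associativity).
Local Notation econvol := (econvol mul inv mu).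
Local Notation convol := (convol mul inv mu).
Local Notation locally_integrable := (locally_integrable mu).
Implicit Types f g h k : G -> R.
Context (theta : G -> R).
Hypothesis ntheta : nonneg_Cc theta.

Let mass : R := fine (\int[mu]_x (theta x)%:E)%E.

(** In the notation of the overview, $f_1$ is [right_avg f], $F$ is [left_avg (right_avg f)] and $X$
    is [left_avg] of the cut-off of $|\xi|$. *)
Definition right_avg f x : R :=
  Num.sqrt (convol (fun z => f z ^+ 2) (fun w => theta (inv w)) x).
Definition left_avg g x : R := Num.sqrt (convol theta (fun z => g z ^+ 2) x).

Lemma mass_ge0 : 0 <= mass.
Proof. by apply: fine_ge0; apply: integral_ge0 => x _; rewrite lee_fin; case: ntheta. Qed.

Lemma Cc_right_avg f : nonneg_Cc f -> nonneg_Cc (right_avg f).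
Proof.
move=> nf; apply: Cc_sqrt; have nV := Cc_inv lcG ntheta.
have [L cL nL] := Cc_support nV.
by apply: (Cc_convol lcG _ (Cc_nonnegB nV) (Cc_locally_integrable lcG muG nV) cL nL); exact: Cc_sqr.
Qed.

Lemma Cc_left_avg g (L : set G) : nonneg_Borel g -> compact L ->
  (forall u, ~ L u -> g u = 0) -> (\int[mu]_x (g x ^+ 2)%:E < +oo)%E ->
  nonneg_Cc (left_avg g).
Proof.
move=> ng cL gL goo; apply: Cc_sqrt; apply: (Cc_convol lcG _ _ _ cL) => //.
- exact: nonnegB_sqr.
- by apply: (locally_integrable_integrable lcG) => //; exact: nonnegB_sqr.
- by move=> u /gL ->; rewrite expr0n.
Qed.

Lemma right_avg_sqr f x : nonneg_Cc f ->
  right_avg f x ^+ 2 = convol (fun z => f z ^+ 2) (fun w => theta (inv w)) x.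
Proof.
move=> nf; rewrite sqr_sqrtr//; apply: convol_ge0; first exact: Cc_sqr.
by apply: Cc_nonnegB; exact: (Cc_inv lcG).
Qed.

Lemma left_avg_sqr g x : nonneg_Borel g -> left_avg g x ^+ 2 = convol theta (fun z => g z ^+ 2) x.
Proof. by move=> ng; rewrite sqr_sqrtr//; apply: convol_ge0 => //; exact: nonnegB_sqr. Qed.

(** The substitution $u \mapsto uy^{-1}$; it exhibits a convolution evaluated at $xy^{-1}$ as one of
    the two integrals required by [cauchy_schwarz_weighted]. *)
Lemma econvol_shift f g x y : nonneg_Cc f -> nonneg_Borel g ->
  econvol f g (x ** inv y) = (\int[mu]_u (f (x ** inv u) * g (u ** inv y))%:E)%E.
Proof.
move=> nf ng; have n1 := nonnegBM (Cc_rdiv lcG (x ** inv y) nf) ng.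
rewrite /econvol -(ge0_integral_mulr lcG muG (inv y)); last 2 first.
- exact: nonnegB_E n1.
- by move=> u; rewrite lee_fin; case: n1.
apply: eq_integral => u _; congr (f _ * _)%:E.
by rewrite (lc_invM lcG) (lc_invK lcG) (lc_mulA lcG) (lc_mulVK lcG).
Qed.

(* Cauchy-Schwarz with respect to [theta (y u^-1) du] for each [y]; integrating
   over [y] first gives the factor [mass], by right invariance. *)
Lemma convol_le_right_left_avg f g (L : set G) x : nonneg_Cc f -> nonneg_Borel g -> compact L ->
  (forall u, ~ L u -> g u = 0) -> locally_integrable g -> (\int[mu]_x (g x ^+ 2)%:E < +oo)%E ->
  mass * convol f g x <= convol (right_avg f) (left_avg g) x.
Proof.
move=> nf ng cL gL lg goo.
pose h u := f (x ** inv u) * g u.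
have nh : nonneg_Borel h by apply: nonnegBM => //; exact: (Cc_rdiv lcG).
have lh : locally_integrable h.
  apply: (locally_integrable_integrable lcG) => //.
  by have [/(_ x)] := econvol_finite_continuous lcG nf ng lg.
have hL u : ~ L u -> h u = 0 by move=> /gL gu; rewrite /h gu mulr0.
have nR := Cc_right_avg nf; have nL := Cc_left_avg ng cL gL goo.
rewrite -lee_fin EFinM -!(convolE lcG)//; last 2 first.
- exact: Cc_nonnegB.
- exact: (Cc_locally_integrable lcG muG).
rewrite -(Cc_integralE lcG muG)// -(integral_econvol lcG muG ntheta nh cL hL).
apply: ge0_le_integral => //.
- by move=> y _; apply: econvol_ge0.
- rewrite (_ : econvol theta h = EFin \o convol theta h); last first.
    by apply/funext => y; rewrite (convolE lcG).
  by apply: nonnegB_E; exact: (nonnegB_convol lcG).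
- apply: nonnegB_E; apply: nonnegBM; last exact: Cc_nonnegB.
  exact: (Cc_rdiv lcG).
move=> y _; rewrite /econvol.
under eq_integral do rewrite mulrA.
have [m1 p1] := Cc_rdiv lcG y ntheta; have [m2 p2] := Cc_rdiv lcG x nf.
have [mg g0] := ng.
(* The two averages unfold to the square roots of the weighted integrals: [left_avg g y] directly,
   and [right_avg f] at $xy^{-1}$ after a shift. *)
apply: cauchy_schwarz_weighted => //; last first.
  by rewrite -(convolE lcG) //; [exact: nonnegB_sqr|apply: (locally_integrable_integrable lcG) => //; exact: nonnegB_sqr].
have nV := Cc_inv lcG ntheta.
rewrite -(convolE lcG); [|exact: Cc_sqr|exact: Cc_nonnegB|exact: (Cc_locally_integrable lcG muG)].
rewrite econvol_shift; [|exact: Cc_sqr|exact: Cc_nonnegB].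
apply: eq_integral => u _; congr _%:E; rewrite mulrC; congr (_ * theta _).
by rewrite (lc_invM lcG) (lc_invK lcG).
Qed.

(* Minkowski's integral inequality for the measure [theta (x u^-1) du]. *)
Lemma convol_sqr_minkowski f g x : nonneg_Cc f -> nonneg_Cc g ->
  convol theta (fun u => convol f g u ^+ 2) x <= convol (left_avg f) g x ^+ 2.
Proof.
move=> nf ng; pose p := convol f g.
have [Lg cLg gLg] := Cc_support ng; have [Lf cLf fLf] := Cc_support nf.
have mg := Cc_nonnegB ng; have lg := Cc_locally_integrable lcG muG ng.
have np : nonneg_Cc p by exact: (Cc_convol lcG nf mg lg cLg).
have np2 := Cc_sqr np; have nf2 := Cc_sqr nf.
have nl : nonneg_Cc (left_avg f).
  by apply: (Cc_left_avg (Cc_nonnegB nf) cLf fLf); exact: (Cc_integral_lty lcG muG).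
set q := convol theta _ x.
have qE : econvol theta (fun u => p u ^+ 2) x = q%:E.
  by apply: (convolE lcG) => //; [exact: Cc_nonnegB|exact: (Cc_locally_integrable lcG muG)].
have q0 : 0 <= q by apply: convol_ge0 => //; exact: Cc_nonnegB.
set r := convol (left_avg f) g x.
have r0 : 0 <= r by exact: convol_ge0.
(* The usual proof of Minkowski: one factor $\sqrt q$ is cancelled at the end, the case $q = 0$
   being trivial. *)
suff : q <= Num.sqrt q * r.
  rewrite -[X in X <= _](sqr_sqrtr q0) expr2.
  move: (sqrtr_ge0 q); rewrite le_eqVlt => /orP[/eqP q00 _|qp].
    by rewrite -(sqr_sqrtr q0) -q00 expr0n sqr_ge0.
  rewrite ler_pM2l// => qr; rewrite -(sqr_sqrtr q0).
  by rewrite lerXn2r// nnegrE sqrtr_ge0.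
rewrite -lee_fin -qE EFinM -(convolE lcG)// /econvol.
have nk : nonneg_Borel (fun u => theta (x ** inv u) * p u).
  by apply: nonnegBM; [exact: (Cc_rdiv lcG)|exact: Cc_nonnegB].
(* Only one of the two factors [p u] is expanded as a convolution integral; the other stays in the
   weight, and the order of integration is then exchanged. *)
have -> : (\int[mu]_u (theta (x ** inv u) * p u ^+ 2)%:E =
    \int[mu]_u \int[mu]_y (f (u ** inv y) * g y * (theta (x ** inv u) * p u))%:E)%E.
  apply: eq_integral => u _.
  under eq_integral do rewrite mulrC EFinM.
  rewrite ge0_integralZl//; last 3 first.
  - by apply: nonnegB_E; apply: nonnegBM => //; exact: (Cc_rdiv lcG).
  - by move=> y _; rewrite lee_fin mulr_ge0//; [case: nf|case: ng].
  - by rewrite lee_fin; case: nk.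
  rewrite (_ : (\int[mu]_y _)%E = econvol f g u)// (convolE lcG)//.
  by rewrite -EFinM expr2 mulrA.
rewrite (conv_tonelli lcG muG nf mg nk cLg gLg).
rewrite -ge0_integralZl//; last 2 first.
- by apply: nonnegB_E; apply: nonnegBM => //; exact: (Cc_rdiv lcG).
- by move=> y _; rewrite lee_fin mulr_ge0//; [case: nl|case: ng].
have [mt t0] := Cc_rdiv lcG x ntheta; have [mp p0] := Cc_nonnegB np.
have E y : (\int[mu]_u (f (u ** inv y) * g y * (theta (x ** inv u) * p u))%:E =
    (g y)%:E * \int[mu]_u (theta (x ** inv u) * p u * f (u ** inv y))%:E)%E.
  have [mfy fy0] := Cc_ldiv lcG y nf.
  rewrite -ge0_integralZl//; last 3 first.
  - by apply: nonnegB_E; apply: nonnegBM => //; exact: (Cc_ldiv lcG).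
  - by move=> u _; rewrite lee_fin mulr_ge0// mulr_ge0.
  - by rewrite lee_fin; case: ng.
  by apply: eq_integral => u _; rewrite -EFinM; congr _%:E; ring.
pose k u := theta (x ** inv u) * p u.
have lk : locally_integrable k.
  apply: (locally_integrable_integrable lcG) => //.
  have [/(_ x)] := econvol_finite_continuous lcG ntheta (Cc_nonnegB np) (Cc_locally_integrable lcG muG np).
  by [].
have nfi := Cc_inv lcG nf.
apply: ge0_le_integral => //.
- by move=> y _; apply: integral_ge0 => u _; rewrite lee_fin !mulr_ge0//; [case: nf|case: ng].
(* Measurability in [y]: the inner integral is [g y] times a convolution with [f \o inv], which is
   continuous. *)
- rewrite (_ : (fun y => _) = EFin \o (fun y => g y * convol (f \o inv) k y)); last first.
    apply/funext => y; rewrite E (_ : (\int[mu]_u _)%E = econvol (f \o inv) k y).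
      by rewrite (convolE lcG).
    apply: eq_integral => u _; congr _%:E.
    by rewrite mulrC /= (lc_invM lcG) (lc_invK lcG).
  by apply: nonnegB_E; apply: nonnegBM => //; exact: (nonnegB_convol lcG).
- apply: measurable_funeM; apply: nonnegB_E; apply: nonnegBM => //; exact: (Cc_rdiv lcG).
move=> y _; rewrite E -EFinM mulrA mulrC EFinM.
apply: lee_wpmul2l; first by rewrite lee_fin; case: ng.
have [mfy fy0] := Cc_ldiv lcG y nf.
(* The two weighted integrals are [q] and the square of [left_avg f] at $xy^{-1}$. *)
apply: cauchy_schwarz_weighted => //.
rewrite -(convolE lcG) //; [|exact: Cc_nonnegB|exact: (Cc_locally_integrable lcG muG)].
rewrite econvol_shift //; exact: Cc_nonnegB.
Qed.

(** Two factors $m^{-1}$ come from squaring [convol_le_right_left_avg]. The third comes from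
    replacing the integral of [p2] by that of its convolution with [theta], to which Minkowski
    applies pointwise. *)
Lemma conv_average f g (L : set G) : nonneg_Cc f -> nonneg_Borel g -> compact L ->
  (forall u, ~ L u -> g u = 0) -> (\int[mu]_x (g x ^+ 2)%:E < +oo)%E ->
  locally_integrable g -> 0 < mass ->
  (\int[mu]_x (convol f g x ^+ 2)%:E <= (mass ^- 3)%:E *
     \int[mu]_x (convol (left_avg (right_avg f)) (left_avg g) x ^+ 2)%:E)%E.
Proof.
move=> nf ng cL gL goo lg m0.
have nR := Cc_right_avg nf; have nL := Cc_left_avg ng cL gL goo.
have [LR cLR fLR] := Cc_support nR; have [LL cLL fLL] := Cc_support nL.
have nLR : nonneg_Cc (left_avg (right_avg f)).
  apply: (Cc_left_avg (Cc_nonnegB nR) cLR fLR).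
  by apply: (Cc_integral_lty lcG muG); exact: Cc_sqr.
have nLm := Cc_nonnegB nL; have nLl := Cc_locally_integrable lcG muG nL.
have np : nonneg_Cc (convol (right_avg f) (left_avg g)) by exact: (Cc_convol lcG nR nLm nLl cLL).
have np2 := Cc_sqr np; have [Lp cLp pLp] := Cc_support np2.
have nc := nonnegB_convol lcG nf ng lg.
have nF := Cc_convol lcG nLR nLm nLl cLL fLL.
have np2l := Cc_locally_integrable lcG muG np2.
have m20 : 0 <= mass ^- 2 by rewrite invr_ge0 exprn_ge0// ltW.
have m10 : 0 <= mass ^-1 by rewrite invr_ge0 ltW.
pose p2 u := convol (right_avg f) (left_avg g) u ^+ 2.
apply: (@le_trans _ _ ((mass ^- 2)%:E * \int[mu]_x (p2 x)%:E)%E).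
  rewrite -(nonnegB_integralZl mu m20 (Cc_nonnegB np2)).
  apply: (nonnegB_le_integral mu (nonnegB_sqr nc) (nonnegBZ m20 (Cc_nonnegB np2))) => x.
  have c0 : 0 <= mass * convol f g x by rewrite mulr_ge0 ?mass_ge0//; case: nc.
  have r0 : 0 <= convol (right_avg f) (left_avg g) x by case: np.
  rewrite ler_pdivlMl ?exprn_gt0// -exprMn lerXn2r ?nnegrE//.
  exact: (convol_le_right_left_avg _ nf ng cL gL lg goo).
rewrite (_ : (mass ^- 3)%:E = ((mass ^- 2)%:E * (mass^-1)%:E)%E); last first.
  by rewrite -EFinM -invfM -exprSr.
rewrite -muleA; apply: lee_wpmul2l; first by rewrite lee_fin.
have p2E : (\int[mu]_x (p2 x)%:E <= (mass^-1)%:E * \int[mu]_x econvol theta p2 x)%E.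
  rewrite (integral_econvol lcG muG ntheta (Cc_nonnegB np2) cLp pLp).
  by rewrite (Cc_integralE lcG muG ntheta) muleA -EFinM mulVf ?gt_eqF// mul1e.
apply: (le_trans p2E); apply: lee_wpmul2l; first by rewrite lee_fin.
rewrite (_ : econvol theta p2 = EFin \o convol theta p2); last first.
  by apply/funext => y; rewrite (convolE lcG)//; exact: (Cc_nonnegB np2).
have nt2 := nonnegB_convol lcG ntheta (Cc_nonnegB np2) np2l.
apply: (nonnegB_le_integral mu nt2 (Cc_nonnegB (Cc_sqr nF))) => x.
exact: convol_sqr_minkowski.
Qed.

Lemma integral_left_avg_sqr g (L : set G) : nonneg_Borel g -> compact L ->
  (forall u, ~ L u -> g u = 0) -> (\int[mu]_x (g x ^+ 2)%:E < +oo)%E ->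
  (\int[mu]_x (left_avg g x ^+ 2)%:E = mass%:E * \int[mu]_x (g x ^+ 2)%:E)%E.
Proof.
move=> ng cL gL goo; have ng2 := nonnegB_sqr ng.
rewrite -(Cc_integralE lcG muG ntheta) -(integral_econvol lcG muG ntheta ng2 cL); last first.
  by move=> u /gL ->; rewrite expr0n.
apply: eq_integral => x _; rewrite left_avg_sqr// (convolE lcG)//.
exact: (locally_integrable_integrable lcG).
Qed.

(** Convolution by [f] on the left has convolution by [f \o inv] as its adjoint, because $f(yu^{-1})
    = (f \circ \mathrm{inv})(uy^{-1})$; Tonelli does the rest. *)
Lemma integral_convol_mul f g k (L : set G) : nonneg_Cc f -> nonneg_Borel g -> nonneg_Borel k -> compact L ->
  (forall u, ~ L u -> g u = 0) -> locally_integrable g -> locally_integrable k ->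
  (\int[mu]_y (convol f g y * k y)%:E = \int[mu]_u (g u * convol (f \o inv) k u)%:E)%E.
Proof.
move=> nf ng nk cL gL lg lk; have nfi := Cc_inv lcG nf.
transitivity (\int[mu]_y \int[mu]_u (f (y ** inv u) * g u * k y)%:E)%E.
  apply: eq_integral => y _; rewrite EFinM -(convolE lcG)// muleC.
  have [_ /(_ y) k0] := nk.
  rewrite -(nonnegB_integralZl mu k0 (nonnegBM (Cc_rdiv lcG y nf) ng)).
  by apply: eq_integral => u _; rewrite mulrC.
rewrite (conv_tonelli lcG muG nf ng nk cL gL).
apply: eq_integral => u _; rewrite EFinM -(convolE lcG)//.
have [_ /(_ u) g0] := ng.
rewrite -(nonnegB_integralZl mu g0 (nonnegBM (Cc_rdiv lcG u nfi) nk)).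
apply: eq_integral => y _; rewrite /= (lc_invM lcG) (lc_invK lcG).
by congr _%:E; ring.
Qed.

(** * Weighted norms of the averages *)

Section weights.
Variables (W : G -> R) (C : R).
Hypotheses (nW : nonneg_Borel W) (lW : locally_integrable W) (C0 : 0 <= C).
Hypothesis WL : forall y u, theta (y ** inv u) != 0 -> W y <= C * W u.
Hypothesis WR : forall u w, theta (inv w) != 0 -> W (u ** w) <= C * W u.

(** When [G] is not unimodular this may differ from [mass]. *)
Let massV : R := fine (\int[mu]_x (theta (inv x))%:E)%E.

(** By duality the convolution is moved onto the weight, and $\int \theta(yu^{-1}) W(y)\,dy \le
    C\,m\,W(u)$ by [WL] and right invariance. *)
Lemma weighted_left_avg g (L : set G) : nonneg_Borel g -> compact L ->
  (forall u, ~ L u -> g u = 0) -> (\int[mu]_x (g x ^+ 2)%:E < +oo)%E ->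
  (\int[mu]_x (left_avg g x ^+ 2 * W x)%:E <=
   (C * mass)%:E * \int[mu]_x (g x ^+ 2 * W x)%:E)%E.
Proof.
move=> ng cL gL goo; have ng2 := nonnegB_sqr ng.
have [mW W0] := nW; have nV := Cc_inv lcG ntheta.
under eq_integral do rewrite (left_avg_sqr _ ng).
rewrite (integral_convol_mul ntheta ng2 nW cL) //; last 2 first.
- by move=> u /gL ->; rewrite expr0n.
- exact: (locally_integrable_integrable lcG).
have Cm0 : 0 <= C * mass by rewrite mulr_ge0// mass_ge0.
rewrite -(nonnegB_integralZl _ Cm0 (nonnegBM ng2 nW)).
have nr : nonneg_Borel (convol (theta \o inv) W) by exact: (nonnegB_convol lcG).
apply: (nonnegB_le_integral mu (nonnegBM ng2 nr) (nonnegBZ Cm0 (nonnegBM ng2 nW))) => u.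
rewrite mulrCA ler_wpM2l ?sqr_ge0// -lee_fin -(convolE lcG)//.
have CW0 : 0 <= C * W u by rewrite mulr_ge0.
have nt := Cc_ldiv lcG u ntheta.
apply: (@le_trans _ _ (\int[mu]_y (C * W u * theta (y ** inv u))%:E)%E).
  apply: (nonnegB_le_integral mu (nonnegBM (Cc_rdiv lcG u nV) nW) (nonnegBZ CW0 nt)) => y.
  rewrite /= (lc_invM lcG) (lc_invK lcG) mulrC.
  have [->|/WL ?] := eqVneq (theta (y ** inv u)) 0; first by rewrite !mulr0.
  by rewrite ler_wpM2r//; case: nt.
rewrite (nonnegB_integralZl mu CW0 nt) (integral_rdiv lcG muG)//.
by rewrite (Cc_integralE lcG muG)// -EFinM mulrAC.
Qed.

(** Duality leaves $\theta(u^{-1}) \int f(v)^2 W(vu)\,dv$ to be integrated over $u$; where the first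
    factor is nonzero, [WR] bounds the inner integral by $C \int f^2 W$. *)
Lemma weighted_right_avg f : nonneg_Cc f ->
  (\int[mu]_x (right_avg f x ^+ 2 * W x)%:E <=
   (C * massV)%:E * \int[mu]_x (f x ^+ 2 * W x)%:E)%E.
Proof.
move=> nf; have nf2 := Cc_sqr nf; have nV := Cc_inv lcG ntheta.
have [mW W0] := nW; have [L cL VL] := Cc_support nV.
under eq_integral do rewrite (right_avg_sqr _ nf).
rewrite (integral_convol_mul nf2 (Cc_nonnegB nV) nW cL) //; last exact: (Cc_locally_integrable lcG muG).
have nf2V := Cc_inv lcG nf2.
have nr : nonneg_Borel (convol ((fun x => f x ^+ 2) \o inv) W) by exact: (nonnegB_convol lcG).
have nfW := nonnegBM (Cc_nonnegB nf2) nW.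
set I := (\int[mu]_x (f x ^+ 2 * W x)%:E)%E.
have I0 : (0 <= I)%E by exact: nonnegB_integral_ge0.
have Ioo : (I < +oo)%E.
  (* The weighted integral [I] is the value at [e] of a convolution, hence finite. *)
  have [/(_ e) + _] := econvol_finite_continuous lcG nf2V nW lW.
  rewrite /econvol /I; under eq_integral do rewrite /= (lc_mul1 lcG) (lc_invK lcG).
  by [].
have IE : I = (fine I)%:E by rewrite fineK// ge0_fin_numE.
have i0 : 0 <= C * fine I by rewrite mulr_ge0// fine_ge0.
have -> : ((C * massV)%:E * I = \int[mu]_x (C * fine I * theta (inv x))%:E)%E.
  rewrite (nonnegB_integralZl mu i0 (Cc_nonnegB nV)) (Cc_integralE lcG muG nV) IE.
  by rewrite -!EFinM mulrAC.
apply: (nonnegB_le_integral mu (nonnegBM (Cc_nonnegB nV) nr) (nonnegBZ i0 (Cc_nonnegB nV))) => u.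
rewrite mulrC; have [->|tu] := eqVneq (theta (inv u)) 0; first by rewrite !mulr0.
rewrite ler_wpM2r//; first by case: nV.
rewrite -lee_fin EFinM -IE -(convolE lcG)// -(nonnegB_integralZl mu C0 nfW) /econvol.
have nWu : nonneg_Borel (fun v => f v ^+ 2 * W (v ** u)).
  apply: nonnegBM; first exact: Cc_nonnegB.
  split=> [|x]; last by [].
  have /measurable_EFinP := measurable_mulr lcG u (nonnegB_E nW).
  by [].
have -> : (\int[mu]_y (((fun x => f x ^+ 2) \o inv) (u ** inv y) * W y)%:E =
    \int[mu]_v (f v ^+ 2 * W (v ** u))%:E)%E.
  rewrite -(ge0_integral_mulr lcG muG (inv u) (nonnegB_E nWu)); last first.
    by move=> v; rewrite lee_fin; case: nWu.
  apply: eq_integral => y _.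
  by rewrite /= (lc_invM lcG) (lc_invK lcG) (lc_mulVK lcG).
apply: (nonnegB_le_integral mu nWu (nonnegBZ C0 nfW)) => v.
by rewrite mulrCA ler_wpM2l ?sqr_ge0// WR.
Qed.

End weights.

End averaging.

(** * Inner regularity and the averaging function *)

(** The integral of a nonnegative function is a supremum over the simple functions below it, hence
    monotone. This serves for integrands such as $|f * \xi|^2$ whose measurability has not been
    established. *)
Lemma ge0_le_integral_nonmeas d (T : measurableType d) (R : realType)
    (mu : {measure set T -> \bar R}) (f g : T -> \bar R) :
  (forall x, 0 <= f x)%E -> (forall x, f x <= g x)%E ->
  (\int[mu]_x f x <= \int[mu]_x g x)%E.
Proof.
move=> f0 fg; rewrite !ge0_integralTE// => [|x]; last exact: le_trans (f0 x) (fg x).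
by apply: le_ereal_sup => _ [h hf <-]; exists h => // x; exact: le_trans (hf x) (fg x).
Qed.

Section reduction.
Context (R : realType) (G : ptopologicalType).
Context (mul : G -> G -> G) (inv : G -> G) (e : G).
Hypothesis lcG : lc_group mul inv e.
Context (mu : {measure set (Borel G) -> \bar R}).
Hypothesis muG : right_haar mul mu.
Local Infix "**" := mul (at level 40, left associativity).
Implicit Types f g h k : G -> R.

Lemma cst_le_integral f (c : R) (A : set G) : nonneg_Borel f -> 0 <= c ->
  measurable (A : set (Borel G)) -> (forall x, A x -> c <= f x) ->
  (c%:E * mu A <= \int[mu]_(x in A) (f x)%:E)%E.
Proof.
move=> [mf f0] c0 mA cf; rewrite -integral_cst//.
apply: ge0_le_integral => //.
- by apply/measurable_EFinP; exact: measurable_funTS.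
Qed.

Lemma nonnegB_integral_gt0 f (U : set G) (c : R) : nonneg_Borel f -> open U -> U !=set0 ->
  0 < c -> (forall x, U x -> c <= f x) -> (0 < \int[mu]_x (f x)%:E)%E.
Proof.
move=> nf oU U0 c0 cf; have mU := open_Borel_measurable oU.
have Upos : (0 < mu U)%E by case: muG => _ _ + _ _; apply.
apply: (@lt_le_trans _ _ (c%:E * mu U)%E); first by rewrite mule_gt0.
apply: (le_trans (cst_le_integral nf (ltW c0) mU cf)); have [mf f0] := nf.
apply: ge0_subset_integral => //; first exact/measurable_EFinP.
by move=> x _; rewrite lee_fin.
Qed.

Lemma Cc_integral_gt0 f (x : G) : nonneg_Cc f -> 0 < f x -> (0 < \int[mu]_x (f x)%:E)%E.
Proof.
move=> nf fx; have [cf _ _] := nf.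
apply: (@nonnegB_integral_gt0 _ [set y | f x / 2 < f y] (f x / 2) (Cc_nonnegB nf)).
- by move/continuousP : cf => /(_ _ (@open_gt _ (f x / 2))).
- by exists x => /=; rewrite ltr_pdivrMr// ltr_pMr// ltr1n.
- by rewrite divr_gt0.
- by move=> y /ltW.
Qed.

(* The sets [f > 1/(n+1)] have finite measure by inner regularity, so some
   sigma-compact set contains [f > 0] up to a null set. *)
Lemma integral_le_compact f (B : \bar R) : continuous f -> (forall x, 0 <= f x) ->
  (forall K : set G, compact K -> (\int[mu]_(x in K) (f x)%:E <= B)%E) ->
  (\int[mu]_x (f x)%:E <= B)%E.
Proof.
move=> cf f0 fB; have nf : nonneg_Borel f by split => //; exact: continuous_Borel_measurable.
have B0 : (0 <= B)%E by apply: le_trans (fB _ compact0); rewrite integral_set0.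
have [->|Boo] := eqVneq B +oo%E; first exact: leey.
have Bfin : B \is a fin_num by rewrite ge0_fin_numE// ltey.
pose U n := [set x | n.+1%:R^-1 < f x].
have n0 n : (0 < n.+1%:R^-1 :> R) by rewrite invr_gt0.
have oU n : open (U n) by move/continuousP : cf => /(_ _ (@open_gt _ n.+1%:R^-1)).
have mU n : measurable (U n : set (Borel G)) by exact: open_Borel_measurable.
have [_ _ _ _ /(_ _ (oU _)) muU] := muG.
(* Every compact subset of [U n] has measure at most $(n+1)B$, and inner regularity passes the bound
   to [U n]. *)
have Uoo n : (mu (U n) < +oo)%E.
  apply: (@le_lt_trans _ _ ((n.+1%:R)%:E * B)%E); last first.
    by rewrite lte_mul_pinfty// ?lee_fin// ltey.
  rewrite muU; apply: ge_ereal_sup => _ [K [cK KU] <-].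
  have := cst_le_integral nf (ltW (n0 n)) (cpt_measurable lcG cK) (fun x Kx => ltW (KU x Kx)).
  move=> /le_trans/(_ (fB _ cK)); rewrite -(fineK Bfin).
  have Kfin : mu K \is a fin_num by rewrite ge0_fin_numE// (compact_mu_lty muG).
  by rewrite -(fineK Kfin) -!EFinM !lee_fin ler_pdivrMl.
have /choice[K KP] n : exists K : set G, [/\ compact K, K `<=` U n &
    (mu (U n `\` K) <= (n.+1%:R^-1)%:E)%E].
  have supfin : ereal_sup [set mu K | K in [set K : set G | compact K /\ K `<=` U n]]
      \is a fin_num by rewrite -muU ge0_fin_numE.
  have [_ [K [cK KU] <-]] := ub_ereal_sup_adherent (n0 n) supfin.
  rewrite -muU => ltK; exists K; split => //; have mK := cpt_measurable lcG cK.
  have Kfin : mu K \is a fin_num by rewrite ge0_fin_numE// (compact_mu_lty muG).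
  have Ufin : mu (U n) \is a fin_num by rewrite ge0_fin_numE.
  have -> : mu (U n `\` K) = (mu (U n) - mu K)%E.
    exact: (etrans (measureD (mU n) mK (Uoo n))
      (congr1 (fun X => mu (U n) - mu X)%E (setIidr KU))).
  move: ltK; rewrite -(fineK Kfin) -(fineK Ufin) -!EFinB lte_fin lee_fin.
  by rewrite ltrBlDr -ltrBlDl => /ltW.
pose L n := \big[setU/set0]_(i < n) K i.
have cL n : compact (L n).
  by rewrite /L; apply: bigsetU_compact => i _; have [] := KP i.
have mL n : measurable (L n : set (Borel G)) by exact: (cpt_measurable lcG).
have mbL : measurable (\bigcup_n L n : set (Borel G)) by exact: bigcupT_measurable.
pose N := \bigcup_m (U m `\` \bigcup_n L n).
have mN : measurable (N : set (Borel G)).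
  by apply: bigcupT_measurable => m; exact: measurableD.
have N0 : mu N = 0%E.
  apply/negligibleP => //; apply: negligible_bigcup => m.
  apply/negligibleP; first exact: measurableD.
  apply/eqP; rewrite -measure_le0; apply/lee_addgt0Pr => eps eps0; rewrite add0e.
  (* Since $n \ge m$, [U m] lies in [U n]; what the union of the [L] misses of [U m] therefore lies
     in [U n] minus [K n], of measure at most $1/(n+1) \le$ [eps]. *)
  pose n := maxn m (Num.trunc eps^-1).
  have [_ KU mUK] := KP n.
  have neps : n.+1%:R^-1 <= eps.
    rewrite -[leRHS]invrK lef_pV2 ?posrE ?invr_gt0//; apply: ltW.
    by apply: lt_le_trans (truncnS_gt _) _; rewrite ler_nat ltnS leq_maxr.
  apply: (@le_trans _ _ (mu (U n `\` K n))); last by apply: (le_trans mUK); rewrite lee_fin.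
  apply: le_measure; rewrite ?inE.
  - exact: measurableD.
  - by apply: measurableD => //; have [cK _ _] := KP n; exact: (cpt_measurable lcG).
  move=> x [Ux nLx]; split.
    apply: le_lt_trans Ux; rewrite lef_pV2 ?posrE// ler_nat ltnS.
    exact: leq_maxl.
  (* [L n] only contains the [K i] with $i < n$, hence the index [n.+1]. *)
  by move=> Kx; apply: nLx; exists n.+1 => //; rewrite /L big_ord_recr; right.
have -> : (\int[mu]_x (f x)%:E = \int[mu]_(x in \bigcup_n L n) (f x)%:E)%E.
  rewrite (ge0_negligible_integral mN)//; last 2 first.
  - exact: nonnegB_E.
  - by move=> x _; rewrite lee_fin.
  rewrite integral_mkcond [RHS]integral_mkcond; apply: eq_integral => x _.
  rewrite !patchE setTD; have [Lx|nLx] := pselect ((\bigcup_n L n) x).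
    by rewrite !mem_set// => -[m _ []].
  rewrite [in RHS]memNset//; case: ifPn => //; rewrite inE => xN; congr _%:E.
  have [//|fx0] := eqVneq (f x) 0; exfalso; apply: xN.
  have fx : 0 < f x by rewrite lt_neqAle eq_sym fx0 f0.
  exists (Num.trunc (f x)^-1) => //; split => //.
  rewrite /U /= -[ltRHS]invrK ltf_pV2 ?posrE ?invr_gt0//.
  exact: truncnS_gt.
have mfL i : measurable_fun (L i : set (Borel G)) (EFin \o f).
  by apply: measurable_funTS; exact: nonnegB_E.
have ndL : nondecreasing_seq (L : (set (Borel G))^nat).
  by move=> m n mn; apply/subsetPset; exact: subset_bigsetU.
have Lf0 (i : nat) (x : Borel G) : L i x -> (0 <= (EFin \o f) x)%E.
  by move=> _; rewrite lee_fin.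
(* Monotone convergence along the increasing compact sets [L n], each of which satisfies the bound
   [B]. *)
have cvgL := ge0_nondecreasing_set_cvg_integral (mu := mu) ndL mL mfL Lf0.
rewrite -(cvg_lim _ cvgL)//; apply: lime_le; first by apply/cvg_ex; eexists; exact: cvgL.
by apply: nearW => n; exact: fB.
Qed.

(** Take $\theta(x) = \int_V \psi(yx)\,dy$ with $V = KH$ compact and $VH = V$. The substitution $y
    \mapsto yh$ preserves both [mu] and $V$, which gives left $H$-invariance by integration on [G]
    alone. *)
Lemma averaging_function (H : set G) : compact_subgroup mul inv e H ->
  exists theta : G -> R, [/\ nonneg_Cc theta,
    forall (h x : G), H h -> theta (h ** x) = theta x & (0 < \int[mu]_x (theta x)%:E)%E].
Proof.
move=> [He HM HV cH]; have [psi [cpsi [S cS psiS] psi0 psie]] := @bump_function R _ _ _ _ lcG.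
have [K cK Ke] := compact_nbhs lcG e.
pose V := [set x | exists2 a, K a & exists2 b, H b & x = a ** b].
have cV : compact V by exact: (compact_mulset lcG).
have mV := cpt_measurable lcG cV.
have VH (v h : G) : H h -> V (v ** h) = V v.
  move=> Hh; apply/propext; split=> [[a Ka [b Hb vE]]|[a Ka [b Hb ->]]].
    exists a => //; exists (b ** inv h); first by apply: HM => //; exact: HV.
    by rewrite (lc_mulA lcG) -vE (lc_mulK lcG).
  by exists a => //; exists (b ** h); [exact: HM|rewrite (lc_mulA lcG)].
have nV : nonneg_Borel (\1_V : G -> R) by exact: nonnegB_indic.
have [mV1 V10] := nV.
have V1 y : ~ V y -> \1_V y = 0 :> R by move=> nVy; rewrite indicE memNset.
have Voo : (\int[mu]_y (\1_V y)%:E < +oo)%E.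
  by rewrite integral_indic// setIT (compact_mu_lty muG).
pose F (p : G * G) := psi (p.2 ** p.1).
have cF : continuous F.
  move=> p; apply: (@continuous_comp _ _ _ (fun p => p.2 ** p.1) psi); last exact: cpsi.
  by apply: (continuous_mul lcG) => q; [exact: cvg_snd|exact: cvg_fst].
have F0 p : 0 <= F p by exact: psi0.
have cI := continuous_param_integral cF F0 cV mV1 V10 V1 Voo.
have Ioo := param_integral_lty cF F0 cV mV1 V10 V1 Voo.
have nF x : nonneg_Borel (fun y => F (x, y) * \1_V y).
  split=> [|y]; last by rewrite mulr_ge0.
  by apply/measurable_EFinP; exact: (measurable_param cF mV1).
pose theta x : R := fine (\int[mu]_y (F (x, y) * \1_V y)%:E)%E.
have I0 x : (0 <= \int[mu]_y (F (x, y) * \1_V y)%:E)%E.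
  by apply: integral_ge0 => y _; rewrite lee_fin mulr_ge0.
have ntheta : nonneg_Cc theta.
  split; [exact: cI|by move=> x; exact: fine_ge0|].
  exists [set x | exists2 a, V (inv a) & exists2 b, S b & x = a ** b].
    by apply: (compact_mulset lcG) => //; exact: (compact_invset lcG).
  move=> x; apply: contra_neqP => nx; rewrite /theta integral0_eq// => y _.
  have [Vy|/V1 ->] := pselect (V y); last by rewrite mulr0.
  have [->|/psiS Sy] := eqVneq (F (x, y)) 0; first by rewrite mul0r.
  exfalso; apply: nx; exists (inv y); first by rewrite (lc_invK lcG).
  by exists (y ** x) => //; rewrite (lc_mulKl lcG).
exists theta; split => //.
  move=> h x Hh; congr fine.
  have nFx := nF x.
  have [_ nFx0] := nFx.
  rewrite -(ge0_integral_mulr lcG muG h (nonnegB_E nFx)); last by move=> y; rewrite lee_fin.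
  apply: eq_integral => y _; rewrite /F /= (lc_mulA lcG); congr (_ * _)%:E.
  by rewrite !indicE; congr (_%:R); congr nat_of_bool; apply/idP/idP; rewrite !inE VH.
apply: (@Cc_integral_gt0 _ e ntheta); rewrite /theta fine_gt0// Ioo andbT.
(* $\theta(e)$ integrates [psi] over $V$, and [psi] exceeds 1/2 on a neighbourhood of [e] inside
   $V$. *)
apply: (@nonnegB_integral_gt0 _ ([set y | 2^-1 < psi y] `&` K^°) 2^-1).
- exact: nF.
- apply: openI; last exact: open_interior.
  by move/continuousP : cpsi => /(_ _ (@open_gt _ 2^-1)).
- by exists e; split => //=; rewrite psie invf_lt1// ltr1n.
- by rewrite invr_gt0.
- move=> y [/= /ltW psiy /interior_subset Ky].
  rewrite /F /= (lc_mulr1 lcG) indicE mem_set ?mulr1//.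
  by exists y => //; exists e => //; rewrite (lc_mulr1 lcG).
Qed.

End reduction.

(** * From the Hecke pair to the group *)

Section weight.
Context (R : realType) (T : ptopologicalType).

Lemma nonnegB_weight (l : T -> R) (s : R) : measurable_fun [set: Borel T] l ->
  nonneg_Borel (fun x => (1 + l x) `^ (2 * s)).
Proof.
move=> ml; split=> [|x]; last exact: powR_ge0.
apply: (measurableT_comp (f := fun x : R => x `^ (2 * s))).
  exact: measurable_powR.
by apply: measurable_funD => //; exact: measurable_cst.
Qed.

(** Because $1 + M + b \le (1+M)(1+b)$, an additive bound on lengths becomes a multiplicative bound
    on weights. *)
Lemma weight_le (M a b s : R) : 0 <= M -> 0 <= a -> 0 <= b -> 0 < s -> a <= M + b ->
  (1 + a) `^ (2 * s) <= (1 + M) `^ (2 * s) * (1 + b) `^ (2 * s).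
Proof.
move=> M0 a0 b0 s0 ab; have s20 : 0 <= 2 * s by rewrite mulr_ge0// ltW.
have Mb0 : 0 <= M * b by rewrite mulr_ge0.
have le1 : 1 + a <= (1 + M) * (1 + b).
  have -> : (1 + M) * (1 + b) = 1 + (M + b) + M * b by ring.
  lra.
rewrite -powRM ?addr_ge0//; apply: ge0_ler_powR => //.
- by rewrite nnegrE addr_ge0.
- by rewrite nnegrE mulr_ge0// addr_ge0.
Qed.

End weight.

(** Cauchy-Schwarz in the plane: the difference of the squares is $(ad+bc)^2$. *)
Lemma mul_sqrt_ge (R : realType) (a b c d : R) :
  `|a * c - b * d| <= Num.sqrt (a ^+ 2 + b ^+ 2) * Num.sqrt (c ^+ 2 + d ^+ 2).
Proof.
rewrite -sqrtrM ?addr_ge0 ?sqr_ge0// -sqrtr_sqr; apply: ler_wsqrtr.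
rewrite -subr_ge0 (_ : _ - _ = (a * d + b * c) ^+ 2); first exact: sqr_ge0.
by ring.
Qed.

Section hecke_to_group.
Context (R : realType) (G : ptopologicalType).
Context (mul : G -> G -> G) (inv : G -> G) (e : G).
Hypothesis lcG : lc_group mul inv e.
Context (mu : {measure set (Borel G) -> \bar R}).
Hypothesis muG : right_haar mul mu.
Local Infix "**" := mul (at level 40, left associativity).
Local Notation convol := (convol mul inv mu).
Local Notation locally_integrable := (locally_integrable mu).

Definition modulus (f : G -> R[i]) x : R := Num.sqrt (sqmod (f x)).

Lemma sqmod_ge0 (z : R[i]) : 0 <= sqmod z.
Proof. by rewrite addr_ge0 ?sqr_ge0. Qed.

Lemma modulus_sqr f x : modulus f x ^+ 2 = sqmod (f x).
Proof. by rewrite sqr_sqrtr// sqmod_ge0. Qed.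

Lemma Cc_modulus (H : set G) f : hecke_elt mul H f -> nonneg_Cc (modulus f).
Proof.
move=> [cre cim [K [cK fK]] _ _]; apply: Cc_sqrt; split.
- move=> x; apply: cvgD; apply: cvgM; by [exact: cre|exact: cim].
- by move=> x; exact: sqmod_ge0.
- exists K => // x fx; apply: fK; apply: contra fx => /eqP ->.
  by rewrite /sqmod /= expr0n addr0.
Qed.

Lemma nonnegB_modulus (H : set G) xi : L2_quot mul mu H xi -> nonneg_Borel (modulus xi).
Proof.
move=> [mre mim _ _]; split; last by move=> x; rewrite sqrtr_ge0.
apply: (measurableT_comp (f := @Num.sqrt R)).
  by apply: continuous_measurable_fun => x; exact: sqrt_continuous.
by apply: measurable_funD; exact: measurable_funX.
Qed.

(** On a compact set, of finite measure, $g \le 1 + g^2$. *)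
Lemma locally_integrable_L2 (g : G -> R) : nonneg_Borel g -> (\int[mu]_x (g x ^+ 2)%:E < +oo)%E -> locally_integrable g.
Proof.
move=> ng goo K cK; have mK := cpt_measurable lcG cK.
have lg2 := locally_integrable_integrable lcG (nonnegB_sqr ng) goo.
have [mg g0] := ng.
apply: (@le_lt_trans _ _ (\int[mu]_(x in K) (1 + (g x ^+ 2)%:E))%E).
  apply: ge0_le_integral => //.
  - by move=> x _; rewrite lee_fin.
  - by apply/measurable_EFinP; exact: measurable_funTS.
  - by apply: emeasurable_funD => //; apply: measurable_funTS; exact: nonnegB_E (nonnegB_sqr ng).
  - move=> x _; rewrite -EFinD lee_fin; have := sqr_ge0 (g x - 1); have := g0 x; nra.
rewrite ge0_integralD//; last 2 first.
- by move=> x _; rewrite lee_fin sqr_ge0.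
- by apply: measurable_funTS; exact: nonnegB_E (nonnegB_sqr ng).
by rewrite integral_cst// mul1e lte_add_pinfty ?lg2// (compact_mu_lty muG).
Qed.

(** Real and imaginary parts are each bounded by the convolution of the moduli, whence the factor
    2. *)
Lemma sqmod_conv_le (f xi : G -> R[i]) (H : set G) x : hecke_elt mul H f ->
  L2_quot mul mu H xi ->
  sqmod (Defs.conv mul inv mu f xi x) <= 2 * convol (modulus f) (modulus xi) x ^+ 2.
Proof.
move=> Hf Hxi; have nf := Cc_modulus Hf; have nxi := nonnegB_modulus Hxi.
have [cre cim _ _ _] := Hf; have [mre mim _ xioo] := Hxi.
have lxi : locally_integrable (modulus xi).
  by apply: locally_integrable_L2 => //; under eq_integral do rewrite modulus_sqr.
have key (u : G -> R) : measurable_fun [set: Borel G] u ->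
    (forall y, `|u y| <= modulus f (x ** inv y) * modulus xi y) ->
    `|Rintegral mu setT u| <= convol (modulus f) (modulus xi) x.
  move=> mu' ule; rewrite -lee_fin -(convolE lcG)//.
  have le1 : (`|\int[mu]_y (u y)%:E| <= econvol mul inv mu (modulus f) (modulus xi) x)%E.
    apply: (le_trans (le_abse_integral _ measurableT _)); first exact/measurable_EFinP.
    by apply: ge0_le_integral_nonmeas => y; rewrite ?abse_ge0//= lee_fin.
  (* The domination just proved makes the integral finite, so [fine] does not fall back on its
     default value. *)
  rewrite -abse_EFin /Rintegral fineK// -abse_fin_num ge0_fin_numE ?abse_ge0//.
  by apply: (le_lt_trans le1); rewrite (convolE lcG)// ltry.
have mfre : measurable_fun [set: Borel G] (fun y => complex.Re (f (x ** inv y))).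
  apply: continuous_Borel_measurable => y.
  apply: (@continuous_comp _ _ _ (fun y => x ** inv y) (fun z => complex.Re (f z))).
    exact: (continuous_ldiv lcG).
  exact: cre.
have mfim : measurable_fun [set: Borel G] (fun y => complex.Im (f (x ** inv y))).
  apply: continuous_Borel_measurable => y.
  apply: (@continuous_comp _ _ _ (fun y => x ** inv y) (fun z => complex.Im (f z))).
    exact: (continuous_ldiv lcG).
  exact: cim.
pose re y := complex.Re (f (x ** inv y) * xi y).
pose im y := complex.Im (f (x ** inv y) * xi y).
have reE y : re y = complex.Re (f (x ** inv y)) * complex.Re (xi y) -
    complex.Im (f (x ** inv y)) * complex.Im (xi y).
  by rewrite /re; case: (f _) => a b; case: (xi y) => c d.
have imE y : im y = complex.Re (f (x ** inv y)) * complex.Im (xi y) +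
    complex.Im (f (x ** inv y)) * complex.Re (xi y).
  by rewrite /im; case: (f _) => a b; case: (xi y) => c d.
have kre : `|Rintegral mu setT re| <= convol (modulus f) (modulus xi) x.
  apply: key => [|y]; last by rewrite reE mul_sqrt_ge.
  rewrite (_ : re = fun y => complex.Re (f (x ** inv y)) * complex.Re (xi y) -
    complex.Im (f (x ** inv y)) * complex.Im (xi y)); last exact/funext.
  by apply: measurable_funB; exact: measurable_funM.
have kim : `|Rintegral mu setT im| <= convol (modulus f) (modulus xi) x.
  apply: key => [|y]; last first.
    (* $ad + bc$ is read as $ad - b(-c)$, so that the bound for real parts applies again. *)
    rewrite imE -[X in _ + X]opprK -mulrN (le_trans (mul_sqrt_ge _ _ _ _))//.
    by rewrite sqrrN [X in _ * Num.sqrt X]addrC.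
  rewrite (_ : im = fun y => complex.Re (f (x ** inv y)) * complex.Im (xi y) +
    complex.Im (f (x ** inv y)) * complex.Re (xi y)); last exact/funext.
  by apply: measurable_funD; exact: measurable_funM.
have r0 : 0 <= convol (modulus f) (modulus xi) x by exact: convol_ge0.
have sq (a : R) : `|a| <= convol (modulus f) (modulus xi) x ->
    a ^+ 2 <= convol (modulus f) (modulus xi) x ^+ 2.
  by move=> h; rewrite -[a ^+ 2]real_normK ?num_real// lerXn2r ?nnegrE.
rewrite mulrDl mul1r; apply: lerD; exact: sq.
Qed.

End hecke_to_group.

(** * Invariance of the averages and the estimate on the group *)

Section main.
Context (R : realType) (G : ptopologicalType).
Context (mul : G -> G -> G) (inv : G -> G) (e : G).
Hypothesis lcG : lc_group mul inv e.
Context (mu : {measure set (Borel G) -> \bar R}).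
Hypothesis muG : right_haar mul mu.
Context (H : set G).
Hypothesis cH : compact_subgroup mul inv e H.
Local Infix "**" := mul (at level 40, left associativity).
Local Notation convol := (convol mul inv mu).
Local Notation locally_integrable := (locally_integrable mu).
Local Notation left_avg := (left_avg mul inv mu).
Local Notation right_avg := (right_avg mul inv mu).

Lemma left_avg_left_invariant (theta g : G -> R) (h x : G) :
  (forall h x, H h -> theta (h ** x) = theta x) -> H h ->
  left_avg theta g (h ** x) = left_avg theta g x.
Proof.
move=> tH Hh; congr (Num.sqrt (fine _)); apply: eq_integral => y _.
by rewrite -(lc_mulA lcG) tH.
Qed.

(** After a shift the translation by [h] appears as $\theta(h^{-1}y^{-1})$, which the left
    invariance of [theta] absorbs. *)
Lemma right_avg_right_invariant (theta f : G -> R) (h x : G) : nonneg_Cc theta -> nonneg_Cc f ->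
  (forall h x, H h -> theta (h ** x) = theta x) -> H h ->
  right_avg theta f (x ** h) = right_avg theta f x.
Proof.
move=> nt nf tH Hh; congr (Num.sqrt (fine _)).
rewrite -{1}[h](lc_invK lcG) (econvol_shift lcG muG); last 2 first.
- exact: Cc_sqr.
- by apply: Cc_nonnegB; exact: (Cc_inv lcG).
apply: eq_integral => y _; congr (_ * _)%:E.
by rewrite (lc_invK lcG) (lc_invM lcG) tH//; case: cH => _ _ + _; apply.
Qed.

Lemma left_avg_right_invariant (theta g : G -> R) (h x : G) : nonneg_Cc theta -> nonneg_Borel g ->
  (forall x, g (x ** h) = g x) -> left_avg theta g (x ** h) = left_avg theta g x.
Proof.
move=> nt ng gH; congr (Num.sqrt (fine _)).
rewrite -{1}[h](lc_invK lcG) (econvol_shift lcG muG)//; last exact: nonnegB_sqr.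
by apply: eq_integral => y _; rewrite (lc_invK lcG) gH.
Qed.

(** Both sides apply [fine] to the same extended integral, so they agree even where it is
    infinite. *)
Lemma sqmod_conv_real (f g : G -> R) x : 
  sqmod (Defs.conv mul inv mu (fun y => f y +i* 0)%C (fun y => g y +i* 0)%C x) =
  convol f g x ^+ 2.
Proof.
rewrite /Defs.conv /cintegral /sqmod /=.
under eq_Rintegral do rewrite mul0r subr0.
under [X in _ + X ^+ 2]eq_Rintegral do rewrite mul0r mulr0 addr0.
by rewrite /Rintegral integral0 expr0n addr0.
Qed.

Lemma sqmod_real (a : R) : sqmod (a +i* 0)%C = a ^+ 2.
Proof. by rewrite /sqmod /= expr0n addr0. Qed.

Lemma hecke_RD_group_RD : hecke_RD mul inv e mu H -> group_RD mul inv e mu.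
Proof.
move=> [l [[[ml l0] le1 lV lM lH] lb [s [c [s0 c0 RD]]]]].
exists l; split => //.
  by split => // h ->.
have [theta [ntheta thetaH tpos]] := averaging_function lcG muG cH.
have [_ _ [S cS thetaS]] := ntheta.
have [M0 lM0] := lb _ cS; pose M := `|M0|.
have lS x : S x -> l x <= M by move=> /lM0 /le_trans; apply; exact: ler_norm.
have M_ge0 : 0 <= M by exact: normr_ge0.
(* With [M] a bound of [l] on the support of [theta], [C] bounds the change of the weight under
   translation by that support. *)
pose C := (1 + M) `^ (2 * s); have C0 : 0 <= C by exact: powR_ge0.
pose W x := (1 + l x) `^ (2 * s).
have nW : nonneg_Borel W by exact: nonnegB_weight.
have WL y u : theta (y ** inv u) != 0 -> W y <= C * W u.
  move=> /thetaS/lS lyu; apply: weight_le => //.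
  by rewrite -{1}(lc_mulVK lcG u y) (le_trans (lM _ _))// lerD2r.
have WR u w : theta (inv w) != 0 -> W (u ** w) <= C * W u.
  move=> /thetaS/lS lw; apply: weight_le => //.
  by rewrite (le_trans (lM _ _))// addrC lerD2r -lV.
have lW : locally_integrable W.
  move=> K cK; have mK := cpt_measurable lcG cK; have [B lB] := lb _ cK.
  apply: (@le_lt_trans _ _ (\int[mu]_(x in K) (((1 + `|B|) `^ (2 * s))%:E))%E).
    apply: ge0_le_integral => //.
    - by move=> x _; rewrite lee_fin powR_ge0.
    - by apply: measurable_funTS; exact: nonnegB_E nW.
    move=> x Kx; rewrite lee_fin; apply: ge0_ler_powR; rewrite ?nnegrE ?addr_ge0//.
      by rewrite mulr_ge0// ltW.
    by rewrite lerD2l (le_trans (lB _ Kx))// ler_norm.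
  by rewrite integral_cst// lte_mul_pinfty ?lee_fin ?powR_ge0// (compact_mu_lty muG).
pose mass := fine (\int[mu]_x (theta x)%:E)%E.
pose massV := fine (\int[mu]_x (theta (inv x))%:E)%E.
have mass0 : 0 < mass by rewrite fine_gt0// tpos (Cc_integral_lty lcG muG).
have massV0 : 0 <= massV.
  by apply: fine_ge0; apply: integral_ge0 => x _; rewrite lee_fin; case: ntheta.
(* The factors come, in order, from [conv_average], the inequality for the Hecke pair, the weighted
   left and right averages in $F$, and the norm of $X$. *)
pose D := mass ^- 3 * (c ^+ 2 * (C * mass) * (C * massV) * mass).
have D0 : 0 <= D.
  by rewrite /D !mulr_ge0// ?invr_ge0 ?exprn_ge0// ltW.
(* The 2 is the loss in [sqmod_conv_le]; adding 1 makes the constant positive while its square still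
   dominates [2 * D]. *)
exists s, (Num.sqrt (2 * D) + 1); split; [by []|exact: ltr_wpDl|].
move=> f Hf xi Hxi.
have nf := Cc_modulus Hf; have nxi := nonnegB_modulus Hxi.
have [_ _ _ xioo] := Hxi.
have xi2 : (\int[mu]_x (modulus xi x ^+ 2)%:E = \int[mu]_x (sqmod (xi x))%:E)%E.
  by apply: eq_integral => x _; rewrite modulus_sqr.
have xi2oo : (\int[mu]_x (modulus xi x ^+ 2)%:E < +oo)%E by rewrite xi2.
have lxi := locally_integrable_L2 lcG muG nxi xi2oo.
set A := wnorm2 mu f l s; set B := (\int[mu]_x (sqmod (xi x))%:E)%E.
have A0 : (0 <= A)%E.
  by apply: integral_ge0 => x _; rewrite lee_fin mulr_ge0 ?sqmod_ge0 ?powR_ge0.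
have B0 : (0 <= B)%E by apply: integral_ge0 => x _; rewrite lee_fin sqmod_ge0.
have [_ crcv] := econvol_finite_continuous lcG nf nxi lxi.
have nr := nonnegB_convol lcG nf nxi lxi.
suff main : (\int[mu]_x (convol (modulus f) (modulus xi) x ^+ 2)%:E <= D%:E * (A * B))%E.
  apply: (@le_trans _ _ (\int[mu]_x (2 * convol (modulus f) (modulus xi) x ^+ 2)%:E)%E).
    apply: ge0_le_integral_nonmeas => x; rewrite lee_fin ?sqmod_ge0//.
    exact: (sqmod_conv_le lcG muG _ Hf Hxi).
  rewrite (nonnegB_integralZl mu _ (nonnegB_sqr nr))//.
  apply: (@le_trans _ _ (2%:E * (D%:E * (A * B)))%E); first by apply: lee_wpmul2l.
  rewrite muleA -EFinM -muleA; apply: lee_wpmul2r; first exact: mule_ge0.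
  have D20 : 0 <= 2 * D by rewrite mulr_ge0.
  rewrite lee_fin -{1}(sqr_sqrtr D20) lerXn2r ?nnegrE ?addr_ge0 ?sqrtr_ge0//.
  by rewrite lerDl.
(* It suffices to bound the integral over each compact [K], where [xi] only matters on a compact [V]
   and may be cut off to it. *)
apply: (integral_le_compact lcG muG).
- by move=> x; apply: cvgM; exact: crcv.
- by move=> x; rewrite sqr_ge0.
move=> K cK; have [V cV KV] := econvol_localize lcG nf cK.
have mK := cpt_measurable lcG cK; have mV := cpt_measurable lcG cV.
pose g y := modulus xi y * \1_V y.
have ng : nonneg_Borel g by exact: (nonnegBM nxi (nonnegB_indic R mV)).
have gV y : ~ V y -> g y = 0 by move=> nVy; rewrite /g indicE memNset// mulr0.
have g2le : (\int[mu]_x (g x ^+ 2)%:E <= B)%E.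
  rewrite /B -xi2; apply: (nonnegB_le_integral mu (nonnegB_sqr ng) (nonnegB_sqr nxi)) => y.
  rewrite /g indicE; case: (_ \in _); first by rewrite mulr1.
  by rewrite mulr0 expr0n sqr_ge0.
have g2oo : (\int[mu]_x (g x ^+ 2)%:E < +oo)%E by rewrite (le_lt_trans g2le).
have lg := locally_integrable_L2 lcG muG ng g2oo.
have rcvK x : K x -> convol (modulus f) (modulus xi) x = convol (modulus f) g x.
  move=> Kx; congr fine; apply: eq_integral => y _; rewrite /g indicE.
  have [->|/(KV _ Kx) Vy] := eqVneq (modulus f (x ** inv y)) 0; first by rewrite !mul0r.
  by rewrite mem_set// mulr1.
have nrg := nonnegB_convol lcG nf ng lg.
pose F := left_avg theta (right_avg theta (modulus f)).
pose X := left_avg theta g.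
have nR := Cc_right_avg lcG muG ntheta nf.
have [LR cLR RLR] := Cc_support nR.
have R2oo := Cc_integral_lty lcG muG (Cc_sqr nR).
have nF : nonneg_Cc F by exact: (Cc_left_avg lcG ntheta (Cc_nonnegB nR) cLR RLR R2oo).
have nX : nonneg_Cc X by exact: (Cc_left_avg lcG ntheta ng cV gV g2oo).
apply: (@le_trans _ _ (\int[mu]_x (convol (modulus f) g x ^+ 2)%:E)%E).
  rewrite (_ : (\int[mu]_(x in K) _ = \int[mu]_(x in K) (convol (modulus f) g x ^+ 2)%:E)%E).
    apply: ge0_subset_integral => //; first exact: nonnegB_E (nonnegB_sqr nrg).
    by move=> x _; rewrite lee_fin sqr_ge0.
  by apply: eq_integral => x; rewrite inE => /rcvK ->.
apply: (le_trans (conv_average lcG muG ntheta nf ng cV gV g2oo lg mass0)).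
rewrite -/mass /D EFinM -muleA; apply: lee_wpmul2l.
  by rewrite lee_fin invr_ge0 exprn_ge0// ltW.
(* Left invariance of $F$ comes from the outer average, right invariance from the inner one, so the
   hypothesis on the pair applies to $F$ and $X$. *)
have HF : hecke_elt mul H (fun x => F x +i* 0)%C.
  have [cF F0 [SF cSF FS]] := nF; split => //.
  - by move=> x; exact: cvg_cst.
  - by exists SF; split => // x Fx; apply: FS; apply: contra Fx => /eqP ->.
  - by move=> h x Hh; rewrite /F left_avg_left_invariant.
  - move=> h x Hh; rewrite /F left_avg_right_invariant//; first exact: Cc_nonnegB.
    by move=> y; rewrite right_avg_right_invariant.
have HX : L2_quot mul mu H (fun x => X x +i* 0)%C.
  split => //.
  - by case: (Cc_nonnegB nX).
  - by move=> h x Hh; rewrite /X left_avg_left_invariant.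
  - under eq_integral do rewrite sqmod_real.
    exact: (Cc_integral_lty lcG muG (Cc_sqr nX)).
have leFX : (\int[mu]_x (convol F X x ^+ 2)%:E <=
    (c ^+ 2)%:E * \int[mu]_x (F x ^+ 2 * W x)%:E * \int[mu]_x (X x ^+ 2)%:E)%E.
  have E1 : (\int[mu]_x (X x ^+ 2)%:E = \int[mu]_x (sqmod (X x +i* 0)%C)%:E)%E.
    by apply: eq_integral => x _; rewrite sqmod_real.
  have E2 : (\int[mu]_x (F x ^+ 2 * W x)%:E = wnorm2 mu (fun x => F x +i* 0%R)%C l s)%E.
    by apply: eq_integral => x _; rewrite sqmod_real.
  rewrite E1 E2; apply: le_trans (RD _ HF _ HX).
  apply: ge0_le_integral_nonmeas => x; first by rewrite lee_fin sqr_ge0.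
  by rewrite sqmod_conv_real.
apply: (le_trans leFX).
have XB : (\int[mu]_x (X x ^+ 2)%:E <= mass%:E * B)%E.
  rewrite /X (integral_left_avg_sqr lcG muG ntheta ng cV gV g2oo).
  by apply: lee_wpmul2l => //; rewrite lee_fin ltW.
have FA : (\int[mu]_x (F x ^+ 2 * W x)%:E <= (C * mass)%:E * ((C * massV)%:E * A))%E.
  apply: (le_trans (weighted_left_avg lcG muG ntheta nW lW C0 WL (Cc_nonnegB nR) cLR RLR R2oo)).
  apply: lee_wpmul2l; first by rewrite lee_fin mulr_ge0// ltW.
  apply: (le_trans (weighted_right_avg lcG muG ntheta nW lW C0 WR nf)).
  apply: lee_wpmul2l; first by rewrite lee_fin mulr_ge0.
  rewrite le_eqVlt; apply/orP; left; apply/eqP; apply: eq_integral => x _.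
  by rewrite modulus_sqr.
apply: (@le_trans _ _ ((c ^+ 2)%:E * ((C * mass)%:E * ((C * massV)%:E * A)) * (mass%:E * B))%E).
  apply: lee_pmul => //.
  - rewrite mule_ge0// ?lee_fin ?sqr_ge0//; apply: integral_ge0 => x _.
    by rewrite lee_fin mulr_ge0 ?sqr_ge0 ?powR_ge0.
  - by apply: integral_ge0 => x _; rewrite lee_fin sqr_ge0.
  - by apply: lee_wpmul2l => //; rewrite lee_fin sqr_ge0.
rewrite !EFinM !muleA (muleAC _ A mass%:E).
by [].
Qed.

End main.

(** * From the group to the Hecke pair *)

Section group_to_hecke.
Context (R : realType) (G : ptopologicalType).
Context (mul : G -> G -> G) (inv : G -> G) (e : G).
Hypothesis lcG : lc_group mul inv e.
Context (mu : {measure set (Borel G) -> \bar R}).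
Context (H : set G).
Hypothesis cH : compact_subgroup mul inv e H.
Local Infix "**" := mul (at level 40, left associativity).

(** * A length function vanishing on the compact subgroup *)

Section length.
Variable l : G -> R.
Hypotheses (l_ge0 : forall x, 0 <= l x) (lV : forall x, l (inv x) = l x).
Hypothesis lM : forall x y, l (x ** y) <= l x + l y.
Hypothesis lb : locally_bounded l.

(** Bounding [l] on the whole double coset $HxH$ makes the resulting function $H$-bi-invariant. *)
Let ball n := [set x | forall h k, H h -> H k -> l (h ** x ** k) <= n%:R].

(** A supremum over the possibly uncountable [H] need not be Borel; passing to interiors makes the
    sublevel sets open. *)
Let oball n := (ball n)^°.

Let ball_mono m n x : (m <= n)%N -> ball m x -> ball n x.
Proof. by move=> mn bx h k Hh Hk; rewrite (le_trans (bx h k Hh Hk))// ler_nat. Qed.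

(** Transports pointwise inequalities for [ball] to [oball] through translations and inversion. *)
Let interior_pull (f : G -> G) m n x : continuous f ->
  (forall y, ball m (f y) -> ball n y) -> oball m (f x) -> oball n x.
Proof.
move=> cf fb bx; have fbx : \forall y \near x, ball m (f y) := cf x _ bx.
by apply: filterS fbx => y; exact: fb.
Qed.

Let oball_cover x : exists n, oball n x.
Proof.
have [He _ _ kH] := cH.
have [K cK Kx] := compact_nbhs lcG x.
have [B lB] := lb cK; have [M lMH] := lb kH.
exists (Num.trunc (M + B + M)).+1; apply: filterS Kx => y Ky h k Hh Hk.
apply: (le_trans (lM _ _)); apply: (@le_trans _ _ (M + B + M)).
  by rewrite lerD ?lMH// (le_trans (lM _ _))// lerD ?lMH ?lB.
by apply/ltW; exact: truncnS_gt.
Qed.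

Let rank x := ex_minn (P := fun n => `[< oball n x >])
  (let: ex_intro n bn := oball_cover x in ex_intro _ n (asboolT bn)).

Let rankP x : oball (rank x) x.
Proof. by rewrite /rank; case: ex_minnP => n /asboolP. Qed.

Let rank_min x n : oball n x -> (rank x <= n)%N.
Proof. by rewrite /rank; case: ex_minnP => m _ + bn; apply; exact/asboolP. Qed.

(** [rank] may be positive on [H], so the value 0 is imposed there; subadditivity survives because
    [rank] does not increase under multiplication by [H] on either side. *)
Definition hecke_length x : R := if `[< H x >] then 0 else (rank x)%:R.

Lemma hecke_length_in x : H x -> hecke_length x = 0.
Proof. by rewrite /hecke_length => /asboolT ->. Qed.

Lemma hecke_length_out x : ~ H x -> hecke_length x = (rank x)%:R.
Proof. by rewrite /hecke_length => /asboolF ->. Qed.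

Lemma hecke_length_ge0 x : 0 <= hecke_length x.
Proof. by rewrite /hecke_length; case: ifP. Qed.

(** Only the second factor is varied: a point $z$ near $xy$ is $x(x^{-1}z)$ with $x^{-1}z$ near $y$,
    and [l] is subadditive on $(hx)(x^{-1}zk)$. *)
Let rankM x y : (rank (x ** y) <= rank x + rank y)%N.
Proof.
have [He _ _ _] := cH.
apply: rank_min; have bx : ball (rank x) x by exact: interior_subset (rankP x).
apply: (@interior_pull (fun z => inv x ** z) (rank y)).
- exact: (continuous_mull lcG).
- move=> z bz h k Hh Hk; rewrite natrD.
  have := bx h e Hh He; have := bz e k He Hk.
  rewrite (lc_mul1 lcG) (lc_mulr1 lcG) => h1 h2.
  rewrite -(lc_mulKVl lcG x z) (lc_mulA lcG) -(lc_mulA lcG (h ** x)).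
  by rewrite (le_trans (lM _ _))// lerD.
- by rewrite (lc_mulKl lcG); exact: rankP.
Qed.

Let rankV x : (rank (inv x) <= rank x)%N.
Proof.
have [_ _ HV _] := cH; apply: rank_min; apply: (@interior_pull inv (rank x)).
- by apply: (continuous_inv lcG) => y; exact: cvg_id.
- move=> y bz h k Hh Hk; rewrite -lV !(lc_invM lcG) (lc_mulA lcG).
  by apply: bz; exact: HV.
- by rewrite (lc_invK lcG); exact: rankP.
Qed.

Let rank_mull h x : H h -> (rank (h ** x) <= rank x)%N.
Proof.
move=> Hh; have [_ HM HV _] := cH; apply: rank_min.
apply: (@interior_pull (fun z => inv h ** z) (rank x)).
- exact: (continuous_mull lcG).
- move=> y bz a k Ha Hk; have := bz (a ** h) k (HM _ _ Ha Hh) Hk.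
  by rewrite -(lc_mulA lcG a) (lc_mulKVl lcG).
- by rewrite (lc_mulKl lcG); exact: rankP.
Qed.

Let rank_mulr h x : H h -> (rank (x ** h) <= rank x)%N.
Proof.
move=> Hh; have [_ HM HV _] := cH; apply: rank_min.
apply: (@interior_pull (fun z => z ** inv h) (rank x)).
- exact: (continuous_mulr lcG).
- move=> y bz a k Ha Hk; have := bz a (h ** k) Ha (HM _ _ Hh Hk).
  by rewrite !(lc_mulA lcG) (lc_mulVK lcG).
- by rewrite (lc_mulK lcG); exact: rankP.
Qed.

Lemma hecke_lengthM x y : hecke_length (x ** y) <= hecke_length x + hecke_length y.
Proof.
have [_ HM _ _] := cH.
have [/hecke_length_in ->|nxy] := pselect (H (x ** y)).
  by rewrite addr_ge0// hecke_length_ge0.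
rewrite (hecke_length_out nxy).
have [Hx|nx] := pselect (H x).
  have ny : ~ H y by move=> Hy; apply: nxy; exact: HM.
  by rewrite (hecke_length_in Hx) add0r (hecke_length_out ny) ler_nat rank_mull.
rewrite (hecke_length_out nx); have [Hy|ny] := pselect (H y).
  by rewrite (hecke_length_in Hy) addr0 ler_nat rank_mulr.
by rewrite (hecke_length_out ny) -natrD ler_nat.
Qed.

Lemma hecke_lengthV x : hecke_length (inv x) = hecke_length x.
Proof.
have [_ _ HV _] := cH; have [Hx|nx] := pselect (H x).
  by rewrite !hecke_length_in//; exact: HV.
rewrite !hecke_length_out//; last by move=> /HV; rewrite (lc_invK lcG).
congr _%:R; apply/eqP; rewrite eqn_leq rankV/=.
by rewrite -{1}(lc_invK lcG x) rankV.
Qed.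

Lemma measurable_hecke_length : measurable_fun [set: Borel G] hecke_length.
Proof.
have [_ _ _ kH] := cH; have mH := cpt_measurable lcG kH.
have mo n : measurable (oball n : set (Borel G)).
  by apply: open_Borel_measurable; exact: open_interior.
move=> _ Y mY; rewrite setTI.
(* Off [H] the length is integer-valued, and it equals [n] exactly on [oball n] minus the smaller
   [oball m]. *)
rewrite (_ : _ @^-1` Y = (H `&` [set x | Y 0]) `|`
    \bigcup_(n in [set n | Y n%:R]) ((oball n `\` \bigcup_(m in [set m | (m < n)%N]) oball m) `\` H)).
  apply: measurableU.
    have [Y0|nY0] := pselect (Y 0).
      rewrite (_ : _ `&` _ = H)//; by apply/seteqP; split=> [x []|].
    rewrite (_ : _ `&` _ = set0); first exact: measurable0.
    by apply/seteqP; split=> [x []|].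
  apply: bigcup_measurable => n _; apply: measurableD => //; apply: measurableD => //.
  by apply: bigcup_measurable => m _; exact: mo.
apply/seteqP; split=> [x /= Yx|x [[Hx Y0]|[n Yn [[bn nb] nHx]]]] /=.
- have [Hx|nx] := pselect (H x); first by left; split => //; rewrite -(hecke_length_in Hx).
  right; exists (rank x); first by rewrite /= -(hecke_length_out nx).
  split => //; split; first exact: rankP.
  by move=> [m /= mr /rank_min]; rewrite leqNgt mr.
- by rewrite hecke_length_in.
- rewrite hecke_length_out// (_ : rank x = n)//.
  apply/eqP; rewrite eqn_leq rank_min//= leqNgt; apply/negP => rn.
  by apply: nb; exists (rank x) => //; exact: rankP.
Qed.

Lemma hecke_length_locally_bounded : locally_bounded hecke_length.
Proof.
move=> K cK; have [||n Kn] := compact_locally_bounded_nat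
  (P := oball) cK; last first.
- exists n%:R => x /Kn bn; rewrite /hecke_length; case: ifP => // _.
  by rewrite ler_nat rank_min.
- by move=> x _; have [n bn] := oball_cover x; exists n; exact: nbhs_interior.
- by move=> m n x mn; apply: filterS => y; exact: ball_mono.
Qed.

(** On [H], [l] is bounded by compactness; off [H], taking $h = k = e$ in the definition of [ball]
    gives $l(x) \le$ [rank x]. *)
Lemma le_hecke_length : exists2 M, 0 <= M & forall x, l x <= M + hecke_length x.
Proof.
have [He _ _ kH] := cH; have [M lMH] := lb kH.
exists `|M|; first exact: normr_ge0.
move=> x; have [Hx|nx] := pselect (H x).
  by rewrite (hecke_length_in Hx) addr0 (le_trans (lMH _ Hx))// ler_norm.
rewrite (hecke_length_out nx) -[leLHS]add0r lerD//.
have := interior_subset (rankP x); move=> /(_ e e He He).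
by rewrite (lc_mul1 lcG) (lc_mulr1 lcG).
Qed.

End length.

(** The convolution is the same for both pairs and $H$-invariant functions are admissible for the
    trivial subgroup, so only the two weights have to be compared. *)
Lemma group_RD_hecke_RD : group_RD mul inv e mu -> hecke_RD mul inv e mu H.
Proof.
move=> [l [[[ml l0] le1 lV lM _] lb [s [c [s0 c0 RD]]]]].
have [He _ _ _] := cH.
pose l' := hecke_length lM lb.
have [M M0 ll'] := le_hecke_length lM lb.
have l'0 : forall x, 0 <= l' x by exact: hecke_length_ge0.
have ml' : measurable_fun [set: Borel G] l' by exact: measurable_hecke_length.
exists l'; split.
- split; [by []|exact: hecke_length_in|exact: hecke_lengthV|exact: hecke_lengthM|].
  by move=> h; exact: hecke_length_in.
- exact: hecke_length_locally_bounded.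
have C0 : 0 <= (1 + M) `^ s by exact: powR_ge0.
(* The square of $(1+M)^s$ is the factor lost in [weight_le] when [l] is replaced by [l']. *)
exists s, (c * (1 + M) `^ s); split; [by []|by rewrite mulr_gt0// powR_gt0// ltr_wpDr|].
move=> f Hf xi Hxi.
have Hf1 : hecke_elt mul [set e] f.
  have [cre cim cf _ _] := Hf; split => // h x ->.
    by rewrite (lc_mul1 lcG).
  by rewrite (lc_mulr1 lcG).
have Hxi1 : L2_quot mul mu [set e] xi.
  have [mre mim _ xioo] := Hxi; split => // h x ->.
  by rewrite (lc_mul1 lcG).
apply: (le_trans (RD f Hf1 xi Hxi1)).
apply: lee_wpmul2r; first by apply: integral_ge0 => x _; rewrite lee_fin sqmod_ge0.
rewrite exprMn [X in (_ <= X * _)%E]EFinM -muleA; apply: lee_wpmul2l; first by rewrite lee_fin sqr_ge0.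
have CE : ((1 + M) `^ s) ^+ 2 = (1 + M) `^ (2 * s).
  by rewrite -powR_mulrn// -powRrM mulrC.
have nf2 : nonneg_Borel (fun x => sqmod (f x)).
  have [mf _] := nonnegB_sqr (Cc_nonnegB (Cc_modulus Hf)); split; last by move=> x; exact: sqmod_ge0.
  by apply: eq_measurable_fun mf => x _; rewrite modulus_sqr.
rewrite CE /wnorm2 -(nonnegB_integralZl mu (powR_ge0 _ _) (nonnegBM nf2 (nonnegB_weight s ml'))).
apply: ge0_le_integral_nonmeas => x.
  by rewrite lee_fin mulr_ge0 ?sqmod_ge0 ?powR_ge0.
rewrite lee_fin mulrCA ler_wpM2l ?sqmod_ge0//; exact: weight_le.
Qed.

End group_to_hecke.

Theorem theorem3p8 (R : realType) (G : ptopologicalType)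
    (mul : G -> G -> G) (inv : G -> G) (e : G)
    (mu : {measure set (Borel G) -> \bar R}) (H : set G) :
  lc_group mul inv e -> right_haar mul mu ->
  compact_subgroup mul inv e H ->
  group_RD mul inv e mu <-> hecke_RD mul inv e mu H.
Proof.
move=> lcG muG cH; split.
  exact: group_RD_hecke_RD.
exact: hecke_RD_group_RD.
Qed.
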